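(* Let $\alpha,\beta>-1$ and $n\in\mathbb N_0$. Define the polynomial spaces (a) $\mathcal U_n^2(W_{\alpha,\beta,-1})=(1-x-y)\mathcal V_{n-1}^2(W_{\alpha,\beta,1})+H_{n,3}(w_{\alpha,\beta})$ for $n\ge0$; (b) $\mathcal U_0^2(W_{\alpha,-1,-1})=\mathrm{span}\{1\}$ and, for $n\ge1$, $\mathcal U_n^2(W_{\alpha,-1,-1})=y(1-x-y)\mathcal V_{n-2}^2(W_{\alpha,1,1})+y\,H_{n-1,3}(w_{\alpha,1})+(1-x-y)H_{n-1,2}(w_{1,\alpha})$; (c) $\mathcal U_0^2(W_{-1,-1,-1})=\mathrm{span}\{1\}$, $\mathcal U_1^2(W_{-1,-1,-1})=\mathrm{span}\{x+c_1,y+c_2\}$ with $c_1,c_2$ arbitrary real constants, and for $n\ge2$, $\mathcal U_n^2(W_{-1,-1,-1})=xy(1-x-y)\mathcal V_{n-3}^2(W_{1,1,1})+xy\,H_{n-2,3}(w_{1,1})+x(1-x-y)H_{n-2,2}(w_{1,1})+y(1-x-y)H_{n-2,1}(w_{1,1})$. Then, in each case (a), (b), (c) with $(a',b',c')$ equal to $(\alpha,\beta,-1)$, $(\alpha,-1,-1)$, $(-1,-1,-1)$ respectively, every element of $\mathcal U_n^2(W_{a',b',c'})$ is a polynomial solution of $L_{a',b',c'}u=-n(n+a'+b'+c'+2)u$, the space $\mathcal U_n^2(W_{a',b',c'})$ consists of polynomials of degree $n$ and has dimension $n+1$, and the sums defining it are direct.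
   Context: $T^2=\{(x,y):x,y\ge0,\ 1-x-y\ge0\}$, $W_{a,b,c}(x,y)=x^ay^b(1-x-y)^c$. For $a,b,c>-1$, $\mathcal V_m^2(W_{a,b,c})$ is the space of polynomials of degree $m$ orthogonal in $L^2(W_{a,b,c},T^2)$ to all polynomials of degree $\le m-1$; $\mathcal V_m^2=\{0\}$ and $H_{m,i}=\{0\}$ if $m<0$. The operator is $L_{a,b,c}u=x(1-x)u_{xx}-2xyu_{xy}+y(1-y)u_{yy}+(a+1-(a+b+c+3)x)u_x+(b+1-(a+b+c+3)y)u_y$. For $a,b>-1$ and $m\ge0$ let $p_m^{(b,a)}(s,t)=t^{-b}(1-s-t)^{-a}\frac{\partial^m}{\partial t^m}\big[t^{b+m}(1-s-t)^{a+m}\big]$ (a polynomial in $(s,t)$), and define the one-dimensional spaces $H_{m,1}(w_{a,b})=\mathrm{span}\{p_m^{(b,a)}(x,y)\}$, $H_{m,2}(w_{a,b})=\mathrm{span}\{p_m^{(b,a)}(y,x)\}$, $H_{m,3}(w_{a,b})=\mathrm{span}\{p_m^{(b,a)}(1-x-y,y)\}$. *)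

(* Defs.v *)
From HB Require Import structures.
From mathcomp Require Import all_boot all_order all_algebra.
From mathcomp Require Import multinomials.mpoly.
From mathcomp Require Import all_classical all_reals all_analysis.

Set Implicit Arguments.
Unset Strict Implicit.
Unset Printing Implicit Defensive.

Import Order.TTheory GRing.Theory Num.Theory.
Import numFieldNormedType.Exports.
Local Open Scope ring_scope.
Local Open Scope classical_set_scope.

Section Defs.
Variable R : realType.

Definition poly2 := {mpoly R[2]}.

Definition i0 : 'I_2 := ord0.
Definition i1 : 'I_2 := ord_max.

Definition pX : poly2 := 'X_i0.
Definition pY : poly2 := 'X_i1.
Definition pC (a : R) : poly2 := a%:MP.

Definition ev (p : poly2) (x y : R) : R :=
  mpoly.meval (fun i : 'I_2 => if i == i0 then x else y) p.

(* total degree: msize p = deg p + 1 for p != 0, msize 0 = 0 *)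
Definition dX (p : poly2) : poly2 := mpoly.mderiv i0 p.
Definition dY (p : poly2) : poly2 := mpoly.mderiv i1 p.

Definition Lop (a b c : R) (u : poly2) : poly2 :=
  pX * (1 - pX) * dX (dX u) - pC 2 * pX * pY * dX (dY u)
  + pY * (1 - pY) * dY (dY u)
  + (pC (a + 1) - pC (a + b + c + 3) * pX) * dX u
  + (pC (b + 1) - pC (a + b + c + 3) * pY) * dY u.

Definition T2 : set (R * R) :=
  [set z | 0 <= z.1 /\ 0 <= z.2 /\ 0 <= 1 - z.1 - z.2].

Definition W (a b c : R) (x y : R) : R :=
  x `^ a * y `^ b * (1 - x - y) `^ c.

Definition inner (a b c : R) (p q : poly2) : \bar R :=
  (\int[(@lebesgue_measure R \x @lebesgue_measure R)%E]_(z in T2)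
     (ev p z.1 z.2 * ev q z.1 z.2 * W a b c z.1 z.2)%:E)%E.

Definition Vsp (a b c : R) (m : int) : set poly2 :=
  fun p => if (m < 0)%R then p = 0
           else (mpoly.msize p <= `|m|.+1)%N /\
                (forall q : poly2, (mpoly.msize q <= `|m|)%N ->
                                   inner a b c p q = 0%E).

(* p_m^{(b,a)}(s,t) = t^{-b} (1-s-t)^{-a} d^m/dt^m [t^{b+m} (1-s-t)^{a+m}],
   as a function on the region t > 0, 1 - s - t > 0 *)
Definition rodr (b a : R) (m : nat) (s t : R) : R :=
  t `^ (- b) * (1 - s - t) `^ (- a) *
  derive1n m (fun u : R => u `^ (b + m%:R) * (1 - s - u) `^ (a + m%:R)) t.

(* H_{m,i}(w_{a,b}): the span of the polynomial p_m^{(b,a)}(...) ; the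
   polynomial is identified through its values on the open region where
   the Rodrigues expression is defined *)
Definition H1 (a b : R) (m : nat) : set poly2 :=
  fun P => exists k : R, forall x y : R, 0 < y -> 0 < 1 - x - y ->
    ev P x y = k * rodr b a m x y.
Definition H2 (a b : R) (m : nat) : set poly2 :=
  fun P => exists k : R, forall x y : R, 0 < x -> 0 < 1 - y - x ->
    ev P x y = k * rodr b a m y x.
Definition H3 (a b : R) (m : nat) : set poly2 :=
  fun P => exists k : R, forall x y : R, 0 < y -> 0 < x ->
    ev P x y = k * rodr b a m (1 - x - y) y.

Definition mulS (q : poly2) (S : set poly2) : set poly2 :=
  fun u => exists2 p, S p & u = q * p.

Definition sumL (Ss : seq (set poly2)) : set poly2 :=
  fun u => exists f : 'I_(size Ss) -> poly2,
    (forall i : 'I_(size Ss), nth set0 Ss i (f i)) /\ u = \sum_(i < size Ss) f i.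

Definition directL (Ss : seq (set poly2)) : Prop :=
  forall f : 'I_(size Ss) -> poly2,
    (forall i : 'I_(size Ss), nth set0 Ss i (f i)) -> \sum_(i < size Ss) f i = 0 -> forall i : 'I_(size Ss), f i = 0.

Definition spanL (s : seq poly2) : set poly2 :=
  fun u => exists c : 'I_(size s) -> R, u = \sum_(i < size s) c i *: s`_i.

Definition has_dim (U : set poly2) (d : nat) : Prop :=
  exists f : 'I_d -> poly2,
    (forall c : 'I_d -> R, \sum_(i < d) c i *: f i = 0 -> forall i, c i = 0) /\
    U = fun u => exists c : 'I_d -> R, u = \sum_(i < d) c i *: f i.

Definition eigen_space (a b c : R) (n : nat) (U : set poly2) : Prop :=
  (forall u, U u -> Lop a b c u = (- (n%:R * (n%:R + a + b + c + 2))) *: u) /\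
  (forall u, U u -> u != 0 -> mpoly.msize u = n.+1) /\
  has_dim U n.+1.

Definition onemXY : poly2 := 1 - pX - pY.

Definition summands_a (al be : R) (n : nat) : seq (set poly2) :=
  [:: mulS onemXY (Vsp al be 1 (n%:Z - 1)); H3 al be n].
Definition Ua (al be : R) (n : nat) : set poly2 := sumL (summands_a al be n).

Definition summands_b (al : R) (n : nat) : seq (set poly2) :=
  [:: mulS (pY * onemXY) (Vsp al 1 1 (n%:Z - 2));
      mulS pY (H3 al 1 n.-1);
      mulS onemXY (H2 1 al n.-1)].
Definition Ub (al : R) (n : nat) : set poly2 :=
  if n is 0 then spanL [:: 1] else sumL (summands_b al n).

Definition summands_c (n : nat) : seq (set poly2) :=
  [:: mulS (pX * pY * onemXY) (Vsp 1 1 1 (n%:Z - 3));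
      mulS (pX * pY) (H3 1 1 (n - 2));
      mulS (pX * onemXY) (H2 1 1 (n - 2));
      mulS (pY * onemXY) (H1 1 1 (n - 2))].
Definition Uc (c1 c2 : R) (n : nat) : set poly2 :=
  match n with
  | 0 => spanL [:: 1]
  | 1 => spanL [:: pX + pC c1; pY + pC c2]
  | _ => sumL (summands_c n)
  end.

End Defs.

(* Main.v *)
(* Only weights [W a b 1] enter the spaces.  For them the moments
   [int x^p y^q] over the triangle satisfy two-term recurrences, read off from
   the two orders of integration; linearly extended, the recurrences say that
   [Lop a b 1] is symmetric for [W a b 1].  Since [Lop a b 1] is triangular with
   respect to the degree, with distinct eigenvalues, and the weighted form is
   positive definite, [Vsp a b 1 m] is exactly the eigenspace of degree [m], and
   products of [Lop a b 1 - eigval i] applied to the monomials of degree [m]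
   give a basis of it.

   The Rodrigues polynomials are homogeneous in two of the three barycentric
   coordinates [x], [y], [z = 1 - x - y], and eigenfunctions when the exponent of
   the third one is [-1]; multiplication by a coordinate turns its exponent from
   [1] into [-1] and raises the degree by one.  So every summand consists of
   eigenfunctions, whose degree is forced by their eigenvalue, and restriction to
   the edges and vertices of the triangle gives directness. *)
Require Import Defs.
From HB Require Import structures.
From mathcomp Require Import all_boot all_order all_algebra.
From mathcomp Require Import multinomials.mpoly.
From mathcomp Require Import all_classical all_reals all_analysis.
From mathcomp Require Import measurable_realfun.
From mathcomp Require Import ring lra.
Import Order.TTheory GRing.Theory Num.Theory.
Import numFieldNormedType.Exports.
Local Open Scope ring_scope.

Set Implicit Arguments.
Unset Strict Implicit.
Unset Printing Implicit Defensive.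

(** * The operator *)

Lemma submm n (m : 'X_{1.. n}) : (m - m)%MM = 0%MM.
Proof. by apply/mnmP=> i; rewrite mnmBE mnm0E subnn. Qed.

Section Operator.
Variable R : realType.
Implicit Types (a b c : R) (p q u : poly2 R).

Lemma dXM p q : dX (p * q) = dX p * q + p * dX q. Proof. exact: mderivM. Qed.
Lemma dYM p q : dY (p * q) = dY p * q + p * dY q. Proof. exact: mderivM. Qed.
Lemma dXD p q : dX (p + q) = dX p + dX q. Proof. exact: mderivD. Qed.
Lemma dYD p q : dY (p + q) = dY p + dY q. Proof. exact: mderivD. Qed.
Lemma dXB p q : dX (p - q) = dX p - dX q. Proof. exact: mderivB. Qed.
Lemma dYB p q : dY (p - q) = dY p - dY q. Proof. exact: mderivB. Qed.
Lemma dXN p : dX (- p) = - dX p. Proof. exact: mderivN. Qed.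
Lemma dYN p : dY (- p) = - dY p. Proof. exact: mderivN. Qed.
Lemma dXC a : dX (pC a) = 0. Proof. exact: mderivC. Qed.
Lemma dYC a : dY (pC a) = 0. Proof. exact: mderivC. Qed.
Lemma dX1 : dX (1 : poly2 R) = 0. Proof. exact: dXC. Qed.
Lemma dY1 : dY (1 : poly2 R) = 0. Proof. exact: dYC. Qed.
Lemma dX0 : dX (0 : poly2 R) = 0. Proof. exact: mderiv0. Qed.
Lemma dY0 : dY (0 : poly2 R) = 0. Proof. exact: mderiv0. Qed.
Lemma dX_nat k : dX (k%:R : poly2 R) = 0. Proof. by rewrite -mpolyC_nat; exact: dXC. Qed.
Lemma dY_nat k : dY (k%:R : poly2 R) = 0. Proof. by rewrite -mpolyC_nat; exact: dYC. Qed.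
Lemma dXX : dX (pX R) = 1.
Proof. by rewrite /dX /pX mderivX mnm1E eqxx scale1r submm mpolyX0. Qed.
Lemma dYY : dY (pY R) = 1.
Proof. by rewrite /dY /pY mderivX mnm1E eqxx scale1r submm mpolyX0. Qed.
Lemma dXY : dX (pY R) = 0.
Proof. by rewrite /dX /pY mderivX mnm1E scale0r. Qed.
Lemma dYX : dY (pX R) = 0.
Proof. by rewrite /dY /pX mderivX mnm1E scale0r. Qed.
Lemma dYdX p : dY (dX p) = dX (dY p).
Proof. exact: mderiv_comm. Qed.

Definition deriv2E :=
  (dXM, dYM, dXD, dYD, dXB, dYB, dXN, dYN, dXC, dYC, dX1, dY1, dX0, dY0, dX_nat, dY_nat, dXX, dYY, dXY, dYX, dYdX).

Lemma dX_exp p k : dX (p ^+ k.+1) = k.+1%:R * p ^+ k * dX p.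
Proof.
elim: k => [|k IH]; first by rewrite !expr1 expr0 !mul1r.
rewrite exprS dXM IH -[k.+2]addn1 natrD (exprS p k); ring.
Qed.
Lemma dY_exp p k : dY (p ^+ k.+1) = k.+1%:R * p ^+ k * dY p.
Proof.
elim: k => [|k IH]; first by rewrite !expr1 expr0 !mul1r.
rewrite exprS dYM IH -[k.+2]addn1 natrD (exprS p k); ring.
Qed.

Lemma Lop_linear a b c : linear (Lop a b c).
Proof. by move=> k u v; rewrite /Lop /dX /dY !linearP /= -!mul_mpolyC /pC; ring. Qed.

HB.instance Definition _ a b c :=
  GRing.isLinear.Build R (poly2 R) (poly2 R) *:%R (Lop a b c) (Lop_linear a b c).

(** The constant [a + b + 2] is the degree [n] eigenvalue for exponents [(a, b, 1)] minus the degree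
    [n + 1] eigenvalue for [(a, b, -1)], whatever [n] is. Hence multiplication by [z] carries
    eigenfunctions to eigenfunctions. *)
Lemma Lop_Z a b p :
  Lop a b (-1) (onemXY R * p) = onemXY R * (Lop a b 1 p - (a + b + 2) *: p).
Proof. by rewrite /Lop /onemXY !deriv2E -!mul_mpolyC /pC; ring. Qed.

Lemma Lop_Y a c p :
  Lop a (-1) c (pY R * p) = pY R * (Lop a 1 c p - (a + c + 2) *: p).
Proof. by rewrite /Lop !deriv2E -!mul_mpolyC /pC; ring. Qed.

Lemma Lop_X b c p :
  Lop (-1) b c (pX R * p) = pX R * (Lop 1 b c p - (b + c + 2) *: p).
Proof. by rewrite /Lop !deriv2E -!mul_mpolyC /pC; ring. Qed.

Definition euler p := pX R * dX p + pY R * dY p.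

(* Both summands on the right integrate to zero against [W a b 1], so this gives
   the symmetry of [Lop a b 1]. *)
Lemma Lop_green a b p q (f := q * dX p - p * dX q) (g := q * dY p - p * dY q) :
  q * Lop a b 1 p - p * Lop a b 1 q =
  (pX R * dX f + pC (a + 1) * f - pX R * (euler f + pC (a + b + 4) * f)) +
  (pY R * dY g + pC (b + 1) * g - pY R * (euler g + pC (a + b + 4) * g)).
Proof. by rewrite /f /g /Lop /euler !deriv2E /pC; ring. Qed.

(** Products of the three barycentric coordinates are not linearly independent, but they make the
    formula for the operator symmetric; those with [k = 0] are the monomials. *)
Definition bary i j k : poly2 R := pX R ^+ i * pY R ^+ j * onemXY R ^+ k.

Lemma dX_onemXY : dX (onemXY R) = -1.
Proof. by rewrite /onemXY !deriv2E; ring. Qed.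
Lemma dY_onemXY : dY (onemXY R) = -1.
Proof. by rewrite /onemXY !deriv2E; ring. Qed.

(* [A1] and [A2] are the first two derivatives of [t ^ k] at [t = p]; the Euler
   equations they satisfy avoid truncated exponents in later computations. *)
Lemma exp_euler p k : exists A1 A2 : poly2 R,
  [/\ dX (p ^+ k) = A1 * dX p, dY (p ^+ k) = A1 * dY p,
      A1 = k%:R * p ^+ k.-1 &
      [/\ dX A1 = A2 * dX p, dY A1 = A2 * dY p, p * A1 = k%:R * p ^+ k
        & p * A2 = (k%:R - 1) * A1]].
Proof.
case: k => [|[|k]].
- exists 0, 0; rewrite expr0 !deriv2E.
  by split; first [ring | split; ring].
- exists 1, 0; rewrite expr1 !deriv2E.
  by split; first [ring | split; ring].
- exists (k.+2%:R * p ^+ k.+1), (k.+2%:R * k.+1%:R * p ^+ k).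
  rewrite !dX_exp !dY_exp !dXM !dYM !dX_exp !dY_exp dX_nat dY_nat /=.
  have -> : k.+2%:R = k%:R + 2%:R :> poly2 R by rewrite -natrD addn2.
  have -> : k.+1%:R = k%:R + 1 :> poly2 R by rewrite natr1.
  rewrite !exprS; move: (dX p) (dY p) (p ^+ k) (k%:R : poly2 R) => x y q n.
  by split; first ring; first ring; first ring; split; ring.
Qed.

(** The pairs [(x, a)], [(y, b)], [(z, c)] play symmetric roles, so one formula serves the monomials
    and the Rodrigues polynomials of all three edges. Truncation of [i.-1] at [i = 0] is harmless
    because its coefficient vanishes there. *)
Lemma Lop_bary a b c i j k : Lop a b c (bary i j k) =
  (i%:R * (i%:R + a)) *: bary i.-1 j k + (j%:R * (j%:R + b)) *: bary i j.-1 k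
  + (k%:R * (k%:R + c)) *: bary i j k.-1
  - ((i + j + k)%:R * ((i + j + k)%:R + a + b + c + 2)) *: bary i j k.
Proof.
have [A1 [A2 [xA yA dA [xA1 yA1 eA eA1]]]] := exp_euler (pX R) i.
have [B1 [B2 [xB yB dB [xB1 yB1 eB eB1]]]] := exp_euler (pY R) j.
have [C1 [C2 [xC yC dC [xC1 yC1 eC eC1]]]] := exp_euler (onemXY R) k.
move: xA yA xA1 yA1 xB yB xB1 yB1 xC yC xC1 yC1.
rewrite dX_onemXY dY_onemXY dXX dYX dXY dYY.
move=> xA yA xA1 yA1 xB yB xB1 yB1 xC yC xC1 yC1.
have -> : (i%:R * (i%:R + a)) *: bary i.-1 j k =
  pC (i%:R + a) * A1 * pY R ^+ j * onemXY R ^+ k.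
  by rewrite dA /bary -mul_mpolyC /pC; ring.
have -> : (j%:R * (j%:R + b)) *: bary i j.-1 k =
  pC (j%:R + b) * pX R ^+ i * B1 * onemXY R ^+ k.
  by rewrite dB /bary -mul_mpolyC /pC; ring.
have -> : (k%:R * (k%:R + c)) *: bary i j k.-1 =
  pC (k%:R + c) * pX R ^+ i * pY R ^+ j * C1.
  by rewrite dC /bary -mul_mpolyC /pC; ring.
rewrite /Lop /bary !(xA, yA, xA1, yA1, xB, yB, xB1, yB1, xC, yC, xC1, yC1, deriv2E).
rewrite !natrD -!mul_mpolyC -!/(pC _).
have pCD x y : pC (x + y) = pC x + pC y :> poly2 R by exact: mpolyCD.
have pCM x y : pC (x * y) = pC x * pC y :> poly2 R by exact: mpolyCM.
have pCn n : pC n%:R = n%:R :> poly2 R by exact: mpolyC_nat.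
rewrite !(pCD, pCM, pCn).
have sub0 (x y : poly2 R) : x = y -> x - y = 0 by move=> ->; rewrite subrr.
move: eA eA1 eB eB1 eC eC1 => /sub0 eA /sub0 eA1 /sub0 eB /sub0 eB1 /sub0 eC /sub0 eC1.
rewrite /onemXY in eC eC1 *.
move: (pX R) (pY R) eA eA1 eB eB1 eC eC1 => X Y.
move: (X ^+ i) (Y ^+ j) (_ ^+ k) => A B C eA eA1 eB eB1 eC eC1.
move: (pC a) (pC b) (pC c) => {}a {}b {}c.
apply/eqP; rewrite -subr_eq0; apply/eqP.
pose s := a + b + c + 3%:R.
(* With powers and constants generalised to variables, the difference of the two sides is an
   explicit combination of the six Euler relations, two for each coordinate. *)
transitivity ((1 - X) * B * C * (X * A2 - (i%:R - 1) * A1)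
 + (1 - Y) * A * C * (Y * B2 - (j%:R - 1) * B1)
 + A * B * (X + Y) * ((1 - X - Y) * C2 - (k%:R - 1) * C1)
 - ((i%:R - 1 + 2%:R * k%:R + s) * B * C + 2%:R * Y * B1 * C) * (X * A1 - i%:R * A)
 - (j%:R - 1 + 2%:R * k%:R + 2%:R * i%:R + s) * A * C * (Y * B1 - j%:R * B)
 - (2%:R * X * A1 * B + 2%:R * Y * A * B1 + (k%:R - 1 + s) * A * B) * ((1 - X - Y) * C1 - k%:R * C)).
  by rewrite /s; ring.
by rewrite eA eA1 eB eB1 eC eC1 !mulr0 !addr0 !subr0.
Qed.

End Operator.

(** * Degrees and eigenpolynomials *)

Section Degree.
Variable R : realType.
Implicit Types (a b c : R) (p q u : poly2 R).

Lemma msize_le_D d p q : (msize p <= d)%N -> (msize q <= d)%N -> (msize (p + q) <= d)%N.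
Proof. by move=> hp hq; rewrite (leq_trans (msizeD_le _ _)) // geq_max hp. Qed.

Lemma msize_le_Z d k p : (msize p <= d)%N -> (msize (k *: p) <= d)%N.
Proof. by move=> hp; rewrite (leq_trans (msizeZ_le _ _)). Qed.

Lemma msize_le_B d p q : (msize p <= d)%N -> (msize q <= d)%N -> (msize (p - q) <= d)%N.
Proof. by move=> hp hq; apply: msize_le_D => //; rewrite mmeasureN. Qed.

Lemma msize_le_M i j p q : (msize p <= i.+1)%N -> (msize q <= j.+1)%N ->
  (msize (p * q) <= (i + j).+1)%N.
Proof.
have [->|p0] := eqVneq p 0; first by rewrite mul0r mmeasure0.
have [->|q0] := eqVneq q 0; first by rewrite mulr0 mmeasure0.
rewrite msizeM // => hp hq.
by rewrite -subn1 leq_subLR add1n -addnS -addSn leq_add.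
Qed.

Lemma msize_le_exp i p : (msize p <= 2)%N -> (msize (p ^+ i) <= i.+1)%N.
Proof.
move=> hp; elim: i => [|i IH]; first by rewrite expr0 mmeasure1.
by rewrite exprS; apply: (@msize_le_M 1 i).
Qed.

Lemma msize_X : (msize (pX R) <= 2)%N. Proof. by rewrite msizeX mdeg1. Qed.
Lemma msize_Y : (msize (pY R) <= 2)%N. Proof. by rewrite msizeX mdeg1. Qed.
Lemma msize_Z : (msize (onemXY R) <= 2)%N.
Proof.
rewrite /onemXY; apply: msize_le_B; last exact: msize_Y.
by apply: msize_le_B; [rewrite mmeasure1 | exact: msize_X].
Qed.

Lemma msize_bary i j k : (msize (bary R i j k) <= (i + j + k).+1)%N.
Proof.
apply: msize_le_M; last exact/msize_le_exp/msize_Z.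
by apply: msize_le_M; apply: msize_le_exp; rewrite ?msize_X ?msize_Y.
Qed.

Lemma mpolyX_bary (m : 'X_{1.. 2}) : 'X_[m] = bary R (m i0) (m i1) 0.
Proof.
rewrite mpolyXE_id /bary expr0 mulr1 big_ord_recl big_ord1.
by congr (_ * 'X__ ^+ m _); apply: val_inj.
Qed.

Lemma mdeg2 (m : 'X_{1.. 2}) : mdeg m = (m i0 + m i1)%N.
Proof.
rewrite mdegE big_ord_recl big_ord1.
by congr (_ + m _)%N; apply: val_inj.
Qed.

Definition eigval a b c (n : nat) : R := - (n%:R * (n%:R + a + b + c + 2)).

(** Triangularity with respect to the degree: by [Lop_bary] with [k = 0], a monomial is mapped to
    its eigenvalue times itself plus terms of lower degree. *)
Lemma Lop_size a b c d p : (msize p <= d.+1)%N ->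
  (msize (Lop a b c p - eigval a b c d *: p) <= d)%N.
Proof.
move=> hp; rewrite (mpolyE p) linear_sum scaler_sumr -sumrB big_seq.
apply: (big_ind (fun q : poly2 R => msize q <= d)%N); first by rewrite mmeasure0.
  by move=> *; apply: msize_le_D.
move=> m mp; rewrite linearZ /= scalerA mulrC -scalerA -scalerBr; apply: msize_le_Z.
have : (mdeg m <= d)%N by rewrite -ltnS (leq_trans (msize_mdeg_lt mp)).
rewrite mpolyX_bary mdeg2; move: (m i0) (m i1) => i j hd.
rewrite Lop_bary mul0r scale0r addr0 -addrA -opprD -scalerDl.
apply: msize_le_B; last first.
  (* In degree exactly [d] the diagonal term cancels; below [d] the monomial is already small
     enough. *)
  have [e|ne] := eqVneq (i + j)%N d.
    by rewrite e addn0 /eigval addrN scale0r mmeasure0.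
  apply/msize_le_Z/(leq_trans (msize_bary _ _ _)).
  by rewrite addn0 ltn_neqAle ne.
apply: msize_le_D.
  case: i hd => [|i] hd; first by rewrite mul0r scale0r mmeasure0.
  by apply/msize_le_Z/(leq_trans (msize_bary _ _ _)); rewrite addn0.
case: j hd => [|j] hd; first by rewrite mul0r scale0r mmeasure0.
by apply/msize_le_Z/(leq_trans (msize_bary _ _ _)); rewrite /= addn0 -addnS.
Qed.

(** The difference of the eigenvalues factors as [(n - d) * (n + d + a + b + c + 2)]. The final
    disjunction rules out the one coincidence: degrees 0 and 1 share the eigenvalue 0 when all three
    exponents are [-1]. *)
Lemma eigval_inj a b c n d : -1 <= a -> -1 <= b -> -1 <= c -> (d < n)%N ->
  (1 < n + d)%N \/ -3 < a + b + c -> eigval a b c d != eigval a b c n.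
Proof.
move=> ha hb hc hdn h; rewrite /eigval.
have hd : d%:R + 1 <= n%:R :> R by rewrite natr1 ler_nat.
have h0 : 0 <= d%:R :> R by [].
rewrite -subr_eq0.
have -> : - (d%:R * (d%:R + a + b + c + 2)) - - (n%:R * (n%:R + a + b + c + 2)) =
  (n%:R - d%:R) * (n%:R + d%:R + a + b + c + 2) :> R by ring.
rewrite mulf_neq0 //; first by lra.
case: h => h; last by lra.
have : 2%:R <= (n + d)%:R :> R by rewrite ler_nat.
rewrite natrD; lra.
Qed.

(** If the degree were some [d < n], then [Lop_size] would put the nonzero multiple
    [(eigval n - eigval d) *: p] of [p] in degree below [d]. *)
Lemma eigen_msize a b c n p : -1 <= a -> -1 <= b -> -1 <= c ->
  (1 < n)%N \/ -3 < a + b + c ->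
  Lop a b c p = eigval a b c n *: p -> (msize p <= n.+1)%N -> p != 0 -> msize p = n.+1.
Proof.
move=> ha hb hc hn hL hs p0; apply/eqP; rewrite eqn_leq hs leqNgt ltnS /=.
apply/negP => hlt; have [d hd] : exists d, msize p = d.+1.
  by exists (msize p).-1; rewrite prednK // lt0n mmeasure_poly_eq0.
have hdn : (d < n)%N by rewrite -hd.
have := @Lop_size a b c d p; rewrite hd leqnn => /(_ isT).
rewrite hL -scalerBl => h; move: h; rewrite msizeZ ?hd ?ltnn //.
rewrite subr_eq0 eq_sym; apply: eigval_inj => //.
by case: hn => hn; [left; exact: leq_trans (leq_addr _ _)|right].
Qed.

(** The falling factorial of a real number, which appears in the [k]-th derivative of a real
    power. *)
Definition ffr (x : R) k := \prod_(i < k) (x - i%:R).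
Lemma ffrS x k : ffr x k.+1 = ffr x k * (x - k%:R).
Proof. by rewrite /ffr big_ord_recr. Qed.
Lemma ffr0 x : ffr x 0 = 1. Proof. exact: big_ord0. Qed.

(** Leibniz coefficients of the [n]-th derivative of [u ^ x * (K - u) ^ y]: [j] derivatives fall on
    the second factor, whence the sign. *)
Definition leibcoef (x y : R) n j := 'C(n, j)%:R * ffr x (n - j) * ((-1) ^+ j * ffr y j).

Definition jcoef b a m := leibcoef (b + m%:R) (a + m%:R) m.

(** This first-order recurrence is exactly what cancels the terms of degree [m - 1] in
    [homjac_eig]. *)
Lemma jcoef_rec b a m j : (j < m)%N ->
  jcoef b a m j.+1 * (j.+1%:R * (j.+1%:R + b)) =
  - jcoef b a m j * ((m - j)%:R * ((m - j)%:R + a)).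
Proof.
move=> jm; rewrite /jcoef /leibcoef.
have := mul_bin_left m j => /(congr1 (fun n => n%:R : R)); rewrite !natrM => hb.
rewrite -(subnSK jm) !ffrS exprS subnSK //.
rewrite !natrB // ?(ltnW jm) // in hb *.
rewrite -natr1 in hb *.
move: (ffr _ _) (ffr _ _) ('C(m, j.+1)%:R : R) ('C(m, j)%:R : R) ((-1) ^+ j) hb => f g B C s hb.
transitivity (- (g * s * f * (a + m%:R - j%:R) * (j%:R + 1 + b)) * ((j%:R + 1) * B)).
  by ring.
by rewrite hb; ring.
Qed.

(** The Rodrigues polynomial as a form of degree [m], with [S] in the place of [1 - s - t] and [T]
    in the place of [t]; a Jacobi polynomial made homogeneous. *)
Definition homjac b a m (S T : poly2 R) :=
  \sum_(j < m.+1) jcoef b a m j *: (S ^+ (m - j) * T ^+ j).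

(** The hypothesis on [L] is what [Lop_bary] becomes when the third coordinate is absent and has
    exponent [-1]. Keeping [L], [S] and [T] abstract covers the three pairs of coordinates at
    once. *)
Lemma homjac_eig b a m (S T : poly2 R) (L : {linear poly2 R -> poly2 R}) :
  (forall i j, L (S ^+ i * T ^+ j) =
     (i%:R * (i%:R + a)) *: (S ^+ i.-1 * T ^+ j)
     + (j%:R * (j%:R + b)) *: (S ^+ i * T ^+ j.-1)
     - ((i + j)%:R * ((i + j)%:R + a + b + 1)) *: (S ^+ i * T ^+ j)) ->
  L (homjac b a m S T) = - (m%:R * (m%:R + a + b + 1)) *: homjac b a m S T.
Proof.
move=> hL; rewrite /homjac linear_sum scaler_sumr /=.
under eq_bigr => j _.
  rewrite linearZ /= hL subnK -1?ltnS // scalerBr scalerDr !scalerA.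
  over.
rewrite sumrB big_split /=.
under [in RHS]eq_bigr => j _ do rewrite scalerA mulrC mulrN scaleNr.
rewrite sumrN -[RHS]add0r; congr (_ - _).
case: m => [|m]; first by rewrite !big_ord1 !mul0r !mulr0 !scale0r addr0.
(* The first sum loses its last term and the second its term at index 0; afterwards index [j] of the
   first meets index [j + 1] of the second. *)
rewrite big_ord_recr /= subnn !mul0r mulr0 scale0r addr0.
rewrite [X in _ + X]big_ord_recl /= !mul0r mulr0 scale0r add0r -big_split big1 //= => j _.
rewrite /bump /= add1n jcoef_rec //.
have jm : (j <= m)%N by rewrite -ltnS.
by rewrite subSS (subSn jm) /= mulNr scaleNr addrN.
Qed.

Lemma ffr_gt0 x k : k%:R - 1 < x -> 0 < ffr x k.
Proof.
move=> hx; apply: prodr_gt0 => i _; rewrite subr_gt0 (le_lt_trans _ hx) //.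
by rewrite lerBrDr natr1 ler_nat.
Qed.

Lemma homjac_msize b a m (S T : poly2 R) : (msize S <= 2)%N -> (msize T <= 2)%N ->
  (msize (homjac b a m S T) <= m.+1)%N.
Proof.
move=> hS hT; apply: (big_ind (fun q : poly2 R => msize q <= m.+1)%N).
- by rewrite mmeasure0.
- by move=> *; apply: msize_le_D.
move=> j _; apply: msize_le_Z.
have e : (m = (m - j) + j)%N by rewrite subnK // -ltnS.
by rewrite [X in (_ <= X.+1)%N]e; apply: msize_le_M; apply: msize_le_exp.
Qed.

(* [eigcomp a b c d] is the product of [L - eigval i] over [i < d]: each factor
   lowers the degree of the next, so it kills degree [< d]. *)
Fixpoint eigcomp a b c d (q : poly2 R) : poly2 R :=
  if d is d'.+1 then
    eigcomp a b c d' (Lop a b c q - eigval a b c d' *: q)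
  else q.

Lemma eigcomp_linear a b c d : linear (eigcomp a b c d).
Proof.
elim: d => //= d IH k u v; rewrite -IH; congr eigcomp.
by rewrite linearP /= -!mul_mpolyC; ring.
Qed.

HB.instance Definition _ a b c d :=
  GRing.isLinear.Build R (poly2 R) (poly2 R) *:%R (eigcomp a b c d) (eigcomp_linear a b c d).

Lemma eigcomp0 a b c d q : (msize q <= d)%N -> eigcomp a b c d q = 0.
Proof.
elim: d q => [|d IH] q /=; first by rewrite leqn0 mmeasure_poly_eq0 => /eqP.
by move=> hq; apply: IH; exact: Lop_size.
Qed.

Lemma Lop_eigcomp a b c d q :
  Lop a b c (eigcomp a b c d q) = eigcomp a b c d (Lop a b c q).
Proof.
by elim: d q => //= d IH q; rewrite IH linearB linearZ.
Qed.

(** The factor [L - eigval d] commutes with [eigcomp] and, applied first, brings [q] down to the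
    degrees that [eigcomp] kills. *)
Lemma eigcomp_eig a b c d q : (msize q <= d.+1)%N ->
  Lop a b c (eigcomp a b c d q) = eigval a b c d *: eigcomp a b c d q.
Proof.
move=> hq; apply/eqP; rewrite -subr_eq0 Lop_eigcomp -linearZ -linearB; apply/eqP.
by apply: eigcomp0; exact: Lop_size.
Qed.

(** On the leading part of degree [m], each factor acts as the scalar [eigval m - eigval i]. *)
Lemma eigcomp_lead a b c m d q : (msize q <= m.+1)%N ->
  (msize (eigcomp a b c d q - (\prod_(i < d) (eigval a b c m - eigval a b c i)) *: q) <= m)%N.
Proof.
elim: d q => [|d IH] q hq; first by rewrite big_ord0 scale1r subrr mmeasure0.
rewrite big_ord_recr /=.
set r := Lop a b c q - _; set P := \prod_(i < d) _.
have hr : (msize (r - (eigval a b c m - eigval a b c d) *: q) <= m)%N.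
  rewrite /r scalerBl opprB addrA subrK.
  exact: Lop_size.
have hr1 : (msize r <= m.+1)%N.
  rewrite -[r](subrK ((eigval a b c m - eigval a b c d) *: q)).
  by apply: msize_le_D; [exact: leqW|exact: msize_le_Z].
have := IH _ hr1; rewrite -/P; clearbody r P => hP.
have -> : eigcomp a b c d r - (P * (eigval a b c m - eigval a b c d)) *: q =
  (eigcomp a b c d r - P *: r) + P *: (r - (eigval a b c m - eigval a b c d) *: q).
  by rewrite scalerBr scalerA addrA subrK.
by apply: msize_le_D => //; exact: msize_le_Z.
Qed.

End Degree.

(** * Moments of the triangle *)

Section PowerIntegral.
Local Open Scope classical_set_scope.
Variable R : realType.
Local Notation mu := (@lebesgue_measure R).

Lemma powR_continuous_at (r x : R) : 0 < x -> {for x, continuous (fun y : R => y `^ r)}.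
Proof.
move=> x0; apply/differentiable_continuous/derivable1_diffP.
by apply: derivable_powR; rewrite in_itv /= x0.
Qed.

Lemma powR_harmonic_cvg0 (t r : R) : 0 < t -> 0 < r ->
  (fun n => (t / n.+2%:R) `^ r) @ \oo --> (0 : R).
Proof.
move=> t0 r0; apply/cvgrPdist_lt => e e0.
have er : 0 < e `^ r^-1 by rewrite powR_gt0.
have h : (t / e `^ r^-1) < (Num.trunc (t / e `^ r^-1)).+1%:R by apply: truncnS_gt.
exists (Num.trunc (t / e `^ r^-1)).+1 => // n /= hn.
rewrite sub0r normrN ger0_norm ?powR_ge0 //.
have -> : e = (e `^ r^-1) `^ r by rewrite -powRrM mulVf ?gt_eqF // powRr1 // ltW.
apply: gt0_ltr_powR; rewrite ?nnegrE ?powR_ge0 //.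
  by rewrite divr_ge0 // ltW.
rewrite ltr_pdivrMr // mulrC -ltr_pdivrMr // (lt_le_trans h) //.
by rewrite ler_nat leqW // leqW.
Qed.

Lemma integral_powR_pos (p e t : R) : -1 < p -> 0 < e -> e < t ->
  (\int[mu]_(x in `[e, t]) (x `^ p)%:E = (t `^ (p + 1) / (p + 1) - e `^ (p + 1) / (p + 1))%:E)%E.
Proof.
move=> p1 e0 et; have p10 : p + 1 != 0 by rewrite gt_eqF //; lra.
pose F (x : R) := x `^ (p + 1) / (p + 1).
have Fd (x : R) : 0 < x -> is_derive x 1 F (x `^ p).
  move=> x0; have := @is_derive1_powR R (p + 1) x x0.
  move=> /(is_deriveZ (p + 1)^-1).
  have -> : (p + 1)^-1 \*: (powR (R:=R))^~ (p + 1) = F.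
    by apply/funext => y; rewrite /F mulrC.
  by rewrite addrK /GRing.scale /= mulrA mulVf // mul1r.
have Fc (x : R) : 0 < x -> {for x, continuous F}.
  move=> /Fd /@ex_derive hd; exact/differentiable_continuous/derivable1_diffP.
rewrite (@continuous_FTC2 R _ F) //.
- apply: continuous_in_subspaceT => x; rewrite inE /= in_itv /= => /andP[ex _].
  by apply: powR_continuous_at; exact: lt_le_trans ex.
- split.
  + by move=> x; rewrite in_itv /= => /andP[ex _]; have [] := Fd x (lt_trans e0 ex).
  + exact/cvg_at_right_filter/Fc.
  + by apply/cvg_at_left_filter/Fc; exact: lt_trans et.
- move=> x; rewrite in_itv /= => /andP[ex _]; have x0 := lt_trans e0 ex.
  by rewrite derive1E; have [] := Fd x x0.
Qed.

Lemma measurable_powR_EFin (p : R) (D : set R) :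
  measurable_fun D (fun x : R => (x `^ p)%:E).
Proof.
apply/measurable_EFinP; apply: measurable_funS (measurable_powR p) => //.
Qed.

(** For [p < 0] the integrand is singular at 0, so the interval is exhausted from the right and
    monotone convergence replaces the fundamental theorem of calculus. *)
Lemma integral_powR (p t : R) : -1 < p -> 0 <= t ->
  (\int[mu]_(x in `[0%R, t]) (x `^ p)%:E = (t `^ (p + 1) / (p + 1))%:E)%E.
Proof.
move=> p1; have p10 : p + 1 != 0 by rewrite gt_eqF //; lra.
rewrite le_eqVlt => /predU1P[<-|t0].
  by rewrite set_itv1 integral_set1 powR0 // mul0r.
rewrite -integral_itv_obnd_cbnd; last exact: measurable_powR_EFin.
(* The denominator [n.+2] keeps the left end strictly below [t] already at [n = 0], as
   [integral_powR_pos] requires. *)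
pose F n : set R := `[t / n.+2%:R, t].
have FE : \bigcup_n F n = `]0, t].
  apply/seteqP; split => [x [n _]|x]; rewrite /F /= !in_itv /=.
    by move=> /andP[h xt]; rewrite xt (lt_le_trans _ h) // divr_gt0.
  move=> /andP[x0 xt]; exists (Num.trunc (t / x)) => //=.
  rewrite in_itv /= xt andbT ler_pdivrMr // mulrC -ler_pdivrMr // ltW //.
  apply: lt_le_trans (truncnS_gt _) _.
  by rewrite ler_nat leqW.
rewrite -FE.
have Fi n : (\int[mu]_(x in F n) (x `^ p)%:E =
    (t `^ (p + 1) / (p + 1) - (t / n.+2%:R) `^ (p + 1) / (p + 1))%:E)%E.
  apply: integral_powR_pos => //; first exact: divr_gt0.
  by rewrite ltr_pdivrMr // ltr_pMr // ltr1n.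
have cv : (\int[mu]_(x in F n) (x `^ p)%:E @[n --> \oo] -->
    \int[mu]_(x in \bigcup_n F n) (x `^ p)%:E)%E.
  apply: ge0_nondecreasing_set_cvg_integral.
  - move=> m n mn; rewrite subsetEset; apply: subset_itvr; rewrite bnd_simp.
    by rewrite ler_pM2l // lef_pV2 ?posrE // ler_nat.
  - by move=> n; exact: measurable_itv.
  - by move=> n; exact: measurable_powR_EFin.
  - by move=> n x _; rewrite lee_fin powR_ge0.
move/cvg_lim : cv => <- //; apply/cvg_lim => //.
under eq_fun do rewrite Fi.
apply: cvg_EFin; first exact: nearW.
rewrite /= -[X in _ --> X]subr0; apply: cvgB; first exact: cvg_cst.
rewrite -(mul0r (p + 1)^-1); apply: cvgMl.
by apply: powR_harmonic_cvg0 => //; lra.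
Qed.

End PowerIntegral.

(** * Two-term recurrences for the moments *)

Section TriangleIntegral.
Local Open Scope classical_set_scope.
Variable R : realType.
Local Notation mu := (@lebesgue_measure R).
Local Notation mu2 := (@lebesgue_measure R \x @lebesgue_measure R)%E.

(** The third factor of [W a b 1] has exponent 1 and can be absorbed into the polynomial; only the
    two real powers remain as a weight. *)
Definition wt (p q : R) (z : R * R) : R := z.1 `^ p * z.2 `^ q.

Lemma measurable_T2 : measurable (@T2 R).
Proof.
have -> : @T2 R = (fst @^-1` `[0, +oo[) `&` (snd @^-1` `[0, +oo[) `&`
   ((fun z : R * R => 1 - z.1 - z.2) @^-1` `[0, +oo[).
  apply/seteqP; split => -[x y]; rewrite /T2 /= !in_itv /= !andbT; first by case=> ? [].
  by case=> -[].
apply: measurableI; first apply: measurableI.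
- by rewrite -[X in measurable X]setTI; by apply: measurable_fst => //; exact: measurable_itv.
- by rewrite -[X in measurable X]setTI; by apply: measurable_snd => //; exact: measurable_itv.
- rewrite -[X in measurable X]setTI.
  have mf : measurable_fun setT (fun z : R * R => 1 - z.1 - z.2).
    apply: measurable_funB; last exact: measurable_snd.
    by apply: measurable_funB; [exact: measurable_cst | exact: measurable_fst].
  by apply: mf => //; exact: measurable_itv.
Qed.

Lemma measurable_wt (p q : R) : measurable_fun setT (wt p q).
Proof.
apply: measurable_funM.
  by apply: (measurableT_comp (measurable_powR p)); exact: measurable_fst.
by apply: (measurableT_comp (measurable_powR q)); exact: measurable_snd.
Qed.

Lemma wt_ge0 (p q : R) z : 0 <= wt p q z.
Proof. by rewrite mulr_ge0 // powR_ge0. Qed.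

Definition betaI (q r : R) : \bar R :=
  (\int[mu]_(y in `[0%R, 1%R]) (y `^ q * (1 - y) `^ r)%:E)%E.

Definition momT (p q : R) : \bar R := (\int[mu2]_(z in @T2 R) (wt p q z)%:E)%E.

Lemma measurable_wtT (p q : R) :
  measurable_fun setT ((fun z => (wt p q z)%:E) \_ (@T2 R)).
Proof.
apply/(measurable_restrictT _ measurable_T2).
by apply/measurable_EFinP; apply: measurable_funS (measurable_wt p q).
Qed.

Lemma wtT_ge0 (p q : R) z : (0 <= ((fun z => (wt p q z)%:E) \_ (@T2 R)) z)%E.
Proof. by rewrite patchE; case: ifP => // _; rewrite lee_fin wt_ge0. Qed.

Lemma measurable_beta (q r : R) (D : set R) :
  measurable_fun D (fun y : R => (y `^ q * (1 - y) `^ r)%:E).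
Proof.
have h : measurable_fun setT (fun y : R => y `^ q * (1 - y) `^ r).
  apply: measurable_funM; first exact: measurable_powR.
  by apply: (measurableT_comp (measurable_powR r)); exact: measurable_funB.
by apply/measurable_EFinP; exact: measurable_funS h.
Qed.

(** The inner integral of Tonelli's theorem, with [r] standing for the factor constant along the
    section; both orders of integration use it. *)
Lemma section_integral (p r t : R) : -1 < p -> 0 <= r ->
  (\int[mu]_x (if [&& 0 <= x, 0 <= t & 0 <= 1 - t - x]%R then (x `^ p * r)%:E else 0) =
  if (0 <= t <= 1)%R then ((p + 1)^-1 * (r * (1 - t) `^ (p + 1)))%:E else 0)%E.
Proof.
move=> p1 r0; case: ifP => ht.
  move: ht => /andP[t0 t1].
  rewrite t0.
  transitivity (\int[mu]_(x in `[0%R, (1 - t)%R]) (r%:E * (x `^ p)%:E))%E.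
    rewrite [RHS]integral_mkcond; apply: eq_integral => x _.
    rewrite patchE mem_setE in_itv /= subr_ge0; case: ifP => // _.
    by rewrite mulrC EFinM.
  rewrite ge0_integralZl_EFin //.
  - rewrite integral_powR // ?subr_ge0 // -EFinM; congr EFin; ring.
  - by move=> x _; rewrite lee_fin powR_ge0.
  - exact: measurable_powR_EFin.
apply: integral0_eq => x _; case: ifP => // /and3P[x0 t0 h].
by move: ht; rewrite t0 /= => /negbT; rewrite -ltNge => h1; exfalso; lra.
Qed.

Lemma momT_betaI2 (p q : R) : -1 < p ->
  (momT p q = ((p + 1)^-1)%:E * betaI q (p + 1))%E.
Proof.
move=> p1; rewrite /momT integral_mkcond fubini_tonelli2.
- rewrite /betaI -ge0_integralZl_EFin //.
  + rewrite [RHS]integral_mkcond; apply: eq_integral => y _.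
    rewrite /fubini_G.
    transitivity (\int[mu]_x (if [&& 0 <= x, 0 <= y & 0 <= 1 - y - x]%R then (x `^ p * y `^ q)%:E else 0))%E.
      apply: eq_integral => x _; rewrite patchE /wt /=.
      congr (if _ then _ else _); apply/idP/idP.
        by rewrite inE /T2 /= => -[-> [-> h]]; rewrite /= addrAC.
      by move=> /and3P[hx hy h]; rewrite inE /T2 /= hx hy addrAC h.
    rewrite section_integral ?powR_ge0 // patchE mem_setE in_itv /=.
    by case: ifP => // _; rewrite EFinM.
  + by move=> y _; rewrite lee_fin mulr_ge0 // powR_ge0.
  + exact: measurable_beta.
  + by rewrite invr_ge0; lra.
- exact: measurable_wtT.
- exact: wtT_ge0.
Qed.

Lemma momT_betaI1 (p q : R) : -1 < q ->
  (momT p q = ((q + 1)^-1)%:E * betaI p (q + 1))%E.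
Proof.
move=> q1; rewrite /momT integral_mkcond fubini_tonelli1.
- rewrite /betaI -ge0_integralZl_EFin //.
  + rewrite [RHS]integral_mkcond; apply: eq_integral => x _.
    rewrite /fubini_F.
    transitivity (\int[mu]_y (if [&& 0 <= y, 0 <= x & 0 <= 1 - x - y]%R then (y `^ q * x `^ p)%:E else 0))%E.
      apply: eq_integral => y _; rewrite patchE /wt /= [_ `^ q * _]mulrC.
      congr (if _ then _ else _); apply/idP/idP.
        by rewrite inE /T2 /= => -[-> [-> h]].
      by move=> /and3P[hx hy h]; rewrite inE /T2 /= hx hy h.
    rewrite section_integral ?powR_ge0 // patchE mem_setE in_itv /=.
    by case: ifP => // _; rewrite EFinM.
  + by move=> y _; rewrite lee_fin mulr_ge0 // powR_ge0.
  + exact: measurable_beta.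
  + by rewrite invr_ge0; lra.
- exact: measurable_wtT.
- exact: wtT_ge0.
Qed.

(** Insert [1 = (1 - y) + y] in the integrand. *)
Lemma betaI_split (q r : R) : -1 < q -> 0 <= r ->
  (betaI q r = betaI q (r + 1) + betaI (q + 1) r)%E.
Proof.
move=> q1 r0; rewrite /betaI -ge0_integralD //.
- apply: eq_integral => y; rewrite inE /= in_itv /= => /andP[y0 y1].
  (* The bound on [s] matters at [x = 0]: since 0 to the power 0 is 1, the identity would fail there
     for [s = -1]. *)
  have aux (x s : R) : 0 <= x -> -1 < s -> x `^ (s + 1) = x `^ s * x.
    move=> x0 hs; rewrite -{3}(powRr1 x0) powRD //; apply/implyP => /eqP hs0; exfalso; lra.
  rewrite -EFinD !aux ?subr_ge0 //; last lra.
  by congr EFin; ring.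
- by move=> y _; rewrite lee_fin mulr_ge0 // powR_ge0.
- exact: measurable_beta.
- by move=> y _; rewrite lee_fin mulr_ge0 // powR_ge0.
- exact: measurable_beta.
Qed.

(** After one integration the factor [(1 - y) ^ (p + 1)] is at most 1, so the integral of [y ^ q]
    dominates. *)
Lemma momT_fin (p q : R) : -1 < p -> -1 < q -> momT p q \is a fin_num.
Proof.
move=> p1 q1; rewrite momT_betaI2 // fin_numM //.
rewrite ge0_fin_numE; last first.
  by apply: integral_ge0 => y _; rewrite lee_fin mulr_ge0 // powR_ge0.
apply: (@le_lt_trans _ _ (\int[mu]_(y in `[0%R, 1%R]) (y `^ q)%:E)%E).
  apply: ge0_le_integral => //.
  - by move=> y _; rewrite lee_fin mulr_ge0 // powR_ge0.
  - exact: measurable_beta.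
  - exact: measurable_powR_EFin.
  - move=> y /=; rewrite in_itv /= => /andP[y0 y1].
    rewrite lee_fin ler_piMr ?powR_ge0 //.
    have e1 : 1 `^ (p + 1) = 1 :> R by rewrite powR1.
    rewrite -[leRHS]e1.
    by apply: ge0_ler_powR; rewrite ?nnegrE; lra.
by rewrite integral_powR // ltry.
Qed.

Definition mom (p q : R) : R := fine (momT p q).

Lemma momTE (p q : R) : -1 < p -> -1 < q -> momT p q = (mom p q)%:E.
Proof. by move=> p1 q1; rewrite fineK // momT_fin. Qed.

(** This is [betaI_split] at exponents [q] and [p + 1], each beta integral being turned back into a
    moment by integrating [x] first. *)
Lemma mom_rel2 (p q : R) : -1 < p -> -1 < q ->
  (p + 1) * mom p q = (p + 2) * mom (p + 1) q + (p + 1) * mom p (q + 1).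
Proof.
move=> p1 q1.
have E (x y : R) : -1 < x -> -1 < y -> betaI y (x + 1) = ((x + 1) * mom x y)%:E.
  move=> hx hy; rewrite EFinM -momTE // momT_betaI2 // muleA -EFinM mulfV ?mul1e //.
  by rewrite gt_eqF //; lra.
have := @betaI_split q (p + 1) q1.
rewrite !E; try lra.
have -> : p + 1 + 1 = p + 2 by ring.
by rewrite -EFinD => h; apply: EFin_inj; apply: h; lra.
Qed.

Lemma mom_rel1 (p q : R) : -1 < p -> -1 < q ->
  (q + 1) * mom p q = (q + 2) * mom p (q + 1) + (q + 1) * mom (p + 1) q.
Proof.
move=> p1 q1.
have E (x y : R) : -1 < x -> -1 < y -> betaI x (y + 1) = ((y + 1) * mom x y)%:E.
  move=> hx hy; rewrite EFinM -momTE // momT_betaI1 // muleA -EFinM mulfV ?mul1e //.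
  by rewrite gt_eqF //; lra.
have := @betaI_split p (q + 1) p1.
rewrite !E; try lra.
have -> : q + 1 + 1 = q + 2 by ring.
by rewrite -EFinD => h; apply: EFin_inj; apply: h; lra.
Qed.

(* The two orders of integration give two linear equations that determine
   [mom (p + 1) q] and [mom p (q + 1)] from [mom p q]. *)
Lemma mom_recl (p q : R) : -1 < p -> -1 < q ->
  (p + q + 3) * mom (p + 1) q = (p + 1) * mom p q.
Proof.
move=> p1 q1; have h1 := mom_rel1 p1 q1; have h2 := mom_rel2 p1 q1.
have : (q + 2) * ((p + 1) * mom p q) - (p + 1) * ((q + 1) * mom p q) =
  (p + q + 3) * mom (p + 1) q by rewrite h1 h2; ring.
by move=> <-; ring.
Qed.

Lemma mom_recr (p q : R) : -1 < p -> -1 < q ->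
  (p + q + 3) * mom p (q + 1) = (q + 1) * mom p q.
Proof.
move=> p1 q1; have h1 := mom_rel1 p1 q1; have h2 := mom_rel2 p1 q1.
have : (p + 2) * ((q + 1) * mom p q) - (q + 1) * ((p + 1) * mom p q) =
  (p + q + 3) * mom p (q + 1) by rewrite h1 h2; ring.
by move=> <-; ring.
Qed.

End TriangleIntegral.

(** * The weighted functional *)

Section Evaluation.
Local Open Scope classical_set_scope.
Variable R : realType.
Implicit Types (p q : poly2 R) (x y : R).

Lemma evD p q x y : ev (p + q) x y = ev p x y + ev q x y. Proof. exact: mevalD. Qed.
Lemma evB p q x y : ev (p - q) x y = ev p x y - ev q x y. Proof. exact: mevalB. Qed.
Lemma evM p q x y : ev (p * q) x y = ev p x y * ev q x y. Proof. exact: mevalM. Qed.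
Lemma evZ k p x y : ev (k *: p) x y = k * ev p x y. Proof. exact: mevalZ. Qed.
Lemma ev0 x y : ev 0 x y = 0. Proof. exact: meval0. Qed.
Lemma ev1 x y : ev 1 x y = 1. Proof. exact: meval1. Qed.
Lemma evE p k x y : ev (p ^+ k) x y = ev p x y ^+ k. Proof. exact: rmorphXn. Qed.
Lemma evX x y : ev (pX R) x y = x. Proof. by rewrite /ev mevalXU. Qed.
Lemma evY x y : ev (pY R) x y = y. Proof. by rewrite /ev mevalXU. Qed.
Lemma evonemXY x y : ev (onemXY R) x y = 1 - x - y.
Proof. by rewrite /onemXY !evB ev1 evX evY. Qed.
Lemma ev_sum (I : Type) (r : seq I) (P : pred I) (F : I -> poly2 R) x y :
  ev (\sum_(i <- r | P i) F i) x y = \sum_(i <- r | P i) ev (F i) x y.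
Proof. exact: raddf_sum. Qed.

Lemma ev_mnm (m : 'X_{1.. 2}) x y : ev 'X_[m] x y = x ^+ m i0 * y ^+ m i1.
Proof. by rewrite mpolyX_bary /bary !evM !evE evX evY expr0 mulr1. Qed.

Lemma ev_continuous p : continuous (fun z : R * R => ev p z.1 z.2).
Proof.
elim/mpolyind: p => [|c m p _ _ IH].
  by under eq_fun do rewrite ev0; exact: cst_continuous.
under eq_fun do rewrite evD evZ ev_mnm.
move=> z; apply: cvgD; last exact: IH.
apply: cvgM; first exact: cvg_cst.
apply: cvgM; apply: (continuous_comp _ (@exprn_continuous R _ _)).
  exact: cvg_fst.
exact: cvg_snd.
Qed.

End Evaluation.

(** * Integration against the weight and symmetry of the operator *)

Section Functional.
Local Open Scope classical_set_scope.
Variable R : realType.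
Local Notation mu := (@lebesgue_measure R).
Local Notation mu2 := (@lebesgue_measure R \x @lebesgue_measure R)%E.
Variables a b : R.
Hypotheses (ha : -1 < a) (hb : -1 < b).
Implicit Types (p q : poly2 R) (x y : R).

(* [lebesgue_measure] lives on [measurableTypeR R], whose measurable structure is
   only convertible to the canonical one of [R]. *)
Lemma measurable_T2_lebesgue : @measurable _ (measurableTypeR R * measurableTypeR R)%type (@T2 R).
Proof. exact: measurable_T2. Qed.

Lemma eq_T2_integrable (f g : R * R -> R) : (forall z, @T2 R z -> f z = g z) ->
  mu2.-integrable (@T2 R) (EFin \o f) -> mu2.-integrable (@T2 R) (EFin \o g).
Proof.
move=> fg.
have := @eq_integrable _ _ R mu2 _ measurable_T2_lebesgue (EFin \o f) (EFin \o g).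
by apply=> z; rewrite inE => hz; rewrite /= fg.
Qed.

Lemma wt_integrable (p q : R) : -1 < p -> -1 < q ->
  mu2.-integrable (@T2 R) (EFin \o wt p q).
Proof.
move=> p1 q1; apply/integrableP; split.
  apply/measurable_EFinP; exact: measurable_funS (measurable_wt p q).
under eq_integral do rewrite /= ger0_norm ?wt_ge0 //.
by have := momTE p1 q1; rewrite /momT => ->; rewrite ltry.
Qed.

Lemma powR_exprn x (r : R) k : 0 <= x -> -1 < r -> x ^+ k * x `^ r = x `^ (r + k%:R).
Proof.
move=> x0 r1; case: k => [|k]; first by rewrite expr0 mul1r addr0.
rewrite -powR_mulrn // mulrC powRD //; apply/implyP => /eqP h; exfalso.
have : 1 <= k.+1%:R :> R by rewrite ler1n.
lra.
Qed.

Lemma wt_mnm i j z : @T2 R z -> (z.1 ^+ i * z.2 ^+ j) * wt a b z = wt (a + i%:R) (b + j%:R) z.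
Proof.
by move=> [z1 [z2 _]]; rewrite /wt -!powR_exprn //; ring.
Qed.

Definition polywt p (z : R * R) : R := ev p z.1 z.2 * wt a b z.

Lemma ltN1_addn (r : R) k : -1 < r -> -1 < r + k%:R.
Proof. by move=> h; rewrite (lt_le_trans h) // lerDl. Qed.

Lemma polywt_integrable p : mu2.-integrable (@T2 R) (EFin \o polywt p).
Proof.
elim/mpolyind: p => [|c m p _ _ IH].
  apply: (@eq_T2_integrable (cst 0)); last exact: (integrable0 mu2).
  by move=> z _; rewrite /polywt /= ev0 mul0r.
have h := integrableZl measurable_T2_lebesgue c (wt_integrable (ltN1_addn (m i0) ha) (ltN1_addn (m i1) hb)).
apply: eq_T2_integrable (integrableD measurable_T2_lebesgue h IH) => z hz.
by rewrite -wt_mnm // /polywt evD evZ ev_mnm; ring.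
Qed.

Definition intxy p : R := \int[mu2]_(z in @T2 R) polywt p z.

Lemma intxy_linear : linear (intxy : poly2 R -> R^o).
Proof.
move=> k u v; change (intxy (k *: u + v) = k * intxy u + intxy v); rewrite /intxy.
rewrite -RintegralZl //; [|exact: measurable_T2_lebesgue|exact: polywt_integrable].
rewrite -RintegralD //; [|exact: measurable_T2_lebesgue| |exact: polywt_integrable].
  by apply: eq_Rintegral => z _; rewrite /polywt evD evZ; ring.
apply: eq_T2_integrable (polywt_integrable (k *: u)) => z _.
by rewrite /polywt evZ mulrA.
Qed.

HB.instance Definition _ := GRing.isLinear.Build R (poly2 R) R^o *:%R intxy intxy_linear.

Lemma intxy_bary i j : intxy (bary R i j 0) = mom (a + i%:R) (b + j%:R).
Proof.
rewrite /intxy /mom /momT /Rintegral; congr fine; apply: eq_integral => z.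
rewrite inE => hz; rewrite /polywt /bary !evM !evE evX evY expr0 mulr1.
by rewrite wt_mnm.
Qed.

Definition intW p : R := intxy (p * onemXY R).

Lemma intW_linear : linear (intW : poly2 R -> R^o).
Proof. by move=> k u v; rewrite /intW mulrDl -scalerAl; exact: intxy_linear. Qed.

HB.instance Definition _ := GRing.isLinear.Build R (poly2 R) R^o *:%R intW intW_linear.

Lemma W_T2 z : @T2 R z -> W a b 1 z.1 z.2 = wt a b z * (1 - z.1 - z.2).
Proof. by move=> [_ [_ h]]; rewrite /W powRr1. Qed.

Lemma inner_lf p q : inner a b 1 p q = (intW (p * q))%:E.
Proof.
rewrite /intW /intxy /Rintegral fineK.
  apply: eq_integral => z; rewrite inE => hz.
  by rewrite /polywt W_T2 // !evM evonemXY; congr EFin; ring.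
exact: (integrable_fin_num measurable_T2_lebesgue (polywt_integrable (p * q * onemXY R))).
Qed.

(** Write [p], [q] for the two exponents. Expanding [z = 1 - x - y] gives three moments, and the
    recurrences leave the factor [(p + q + 3) - (p + 1) - (q + 1) = 1]. *)
Lemma intW_bary i j : (a + i%:R + (b + j%:R) + 3) * intW (bary R i j 0) = mom (a + i%:R) (b + j%:R).
Proof.
have -> : intW (bary R i j 0) = mom (a + i%:R) (b + j%:R)
    - mom (a + i%:R + 1) (b + j%:R) - mom (a + i%:R) (b + j%:R + 1).
  rewrite /intW.
  have -> : bary R i j 0 * onemXY R = bary R i j 0 - bary R i.+1 j 0 - bary R i j.+1 0.
    by rewrite /bary !exprS /onemXY; ring.
  by rewrite !linearB /= !intxy_bary -!natr1 !addrA.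
have h1 := mom_recl (ltN1_addn i ha) (ltN1_addn j hb).
have h2 := mom_recr (ltN1_addn i ha) (ltN1_addn j hb).
by rewrite !mulrBr h1 h2; ring.
Qed.

Lemma mass_neq0 i j : a + i%:R + (b + j%:R) + 3 != 0.
Proof.
have := ltN1_addn i ha; have := ltN1_addn j hb.
by move: (a + _) (b + _) => u v h1 h2; rewrite gt_eqF //; lra.
Qed.

Lemma intW_recl i j :
  (a + b + 4 + (i + j)%:R) * intW (bary R i.+1 j 0) = (a + 1 + i%:R) * intW (bary R i j 0).
Proof.
have h1 := mom_recl (ltN1_addn i ha) (ltN1_addn j hb).
have := intW_bary i.+1 j; have := intW_bary i j.
rewrite -(natr1 i) (addrA a) => e1 e2; rewrite -e1 -e2 in h1.
apply: (mulfI (mass_neq0 i j)); rewrite natrD.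
transitivity ((a + i%:R + (b + j%:R) + 3) *
   ((a + i%:R + 1 + (b + j%:R) + 3) * intW (bary R i.+1 j 0))); first by ring.
by rewrite h1; ring.
Qed.

Lemma intW_recr i j :
  (a + b + 4 + (i + j)%:R) * intW (bary R i j.+1 0) = (b + 1 + j%:R) * intW (bary R i j 0).
Proof.
have h1 := mom_recr (ltN1_addn i ha) (ltN1_addn j hb).
have := intW_bary i j.+1; have := intW_bary i j.
rewrite -(natr1 j) (addrA b) => e1 e2; rewrite -e1 -e2 in h1.
apply: (mulfI (mass_neq0 i j)); rewrite natrD.
transitivity ((a + i%:R + (b + j%:R) + 3) *
   ((a + i%:R + (b + j%:R + 1) + 3) * intW (bary R i j.+1 0))); first by ring.
by rewrite h1; ring.
Qed.

Lemma linear_bary_eq0 (f : poly2 R -> R) :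
  (forall k u v, f (k *: u + v) = k * f u + f v) ->
  (forall i j, f (bary R i j 0) = 0) -> forall p, f p = 0.
Proof.
move=> fL f0.
have fz : f 0 = 0 by have := fL (-1) 0 0; rewrite scaler0 add0r mulN1r addNr.
elim/mpolyind => [//|c m p _ _ IH].
by rewrite fL IH mpolyX_bary f0 mulr0 addr0.
Qed.

(** Times the weight, this is the divergence of the field [W a b 1 * x * f * (1 - x, - y)], which
    has no flux through the edges; likewise for [greenY] with [y] and [(- x, 1 - y)]. *)
Definition greenX f : poly2 R :=
  pX R * dX f + pC (a + 1) * f - pX R * (euler f + pC (a + b + 4) * f).
Definition greenY f : poly2 R :=
  pY R * dY f + pC (b + 1) * f - pY R * (euler f + pC (a + b + 4) * f).

Lemma intW_greenX_linear k u v :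
  intW (greenX (k *: u + v)) = k * intW (greenX u) + intW (greenX v).
Proof.
rewrite -[k * _]/(k *: (_ : R^o)) -linearP /=; congr intW.
by rewrite /greenX /euler /dX /dY !linearP /= -!mul_mpolyC /pC; ring.
Qed.
Lemma intW_greenY_linear k u v :
  intW (greenY (k *: u + v)) = k * intW (greenY u) + intW (greenY v).
Proof.
rewrite -[k * _]/(k *: (_ : R^o)) -linearP /=; congr intW.
by rewrite /greenY /euler /dX /dY !linearP /= -!mul_mpolyC /pC; ring.
Qed.
Lemma X_dX_bary i j : pX R * dX (bary R i j 0) = i%:R *: bary R i j 0.
Proof.
have [A1 [A2 [xA yA _ [_ _ eA _]]]] := exp_euler (pX R) i.
have [B1 [B2 [xB yB _ _]]] := exp_euler (pY R) j.
rewrite /bary expr0 mulr1 dXM xA xB dXX dXY -mul_mpolyC.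
transitivity (pX R * A1 * pY R ^+ j); first by ring.
by rewrite eA; ring.
Qed.

Lemma Y_dY_bary i j : pY R * dY (bary R i j 0) = j%:R *: bary R i j 0.
Proof.
have [A1 [A2 [xA yA _ _]]] := exp_euler (pX R) i.
have [B1 [B2 [xB yB _ [_ _ eB _]]]] := exp_euler (pY R) j.
rewrite /bary expr0 mulr1 dYM yA yB dYX dYY -mul_mpolyC.
transitivity (pX R ^+ i * (pY R * B1)); first by ring.
by rewrite eB; ring.
Qed.

(** By linearity [f] may be a monomial, and then the claim is [intW_recl]; no boundary terms have to
    be handled. *)
Lemma intW_greenX f : intW (greenX f) = 0.
Proof.
apply: (linear_bary_eq0 intW_greenX_linear) f => i j.
rewrite /greenX /euler X_dX_bary Y_dY_bary.
have -> : pX R * (i%:R *: bary R i j 0 + j%:R *: bary R i j 0 +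
    pC (a + b + 4) * bary R i j 0) = (a + b + 4 + (i + j)%:R) *: bary R i.+1 j 0.
  by rewrite /bary exprS /pC -!mul_mpolyC; ring.
rewrite /pC mul_mpolyC -scalerDl [_%:R + (_ + 1)]addrC.
transitivity ((a + 1 + i%:R) * intW (bary R i j 0) - (a + b + 4 + (i + j)%:R) * intW (bary R i.+1 j 0)).
  by rewrite linearB !linearZ.
by rewrite intW_recl subrr.
Qed.

Lemma intW_greenY f : intW (greenY f) = 0.
Proof.
apply: (linear_bary_eq0 intW_greenY_linear) f => i j.
rewrite /greenY /euler X_dX_bary Y_dY_bary.
have -> : pY R * (i%:R *: bary R i j 0 + j%:R *: bary R i j 0 +
    pC (a + b + 4) * bary R i j 0) = (a + b + 4 + (i + j)%:R) *: bary R i j.+1 0.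
  by rewrite /bary exprS /pC -!mul_mpolyC; ring.
rewrite /pC mul_mpolyC -scalerDl [_%:R + (_ + 1)]addrC.
transitivity ((b + 1 + j%:R) * intW (bary R i j 0) - (a + b + 4 + (i + j)%:R) * intW (bary R i j.+1 0)).
  by rewrite linearB !linearZ.
by rewrite intW_recr subrr.
Qed.

Lemma Lop_selfadjoint p q : intW (q * Lop a b 1 p) = intW (p * Lop a b 1 q).
Proof.
apply/eqP; rewrite -subr_eq0 -linearB Lop_green linearD /=.
by rewrite -/(greenX _) -/(greenY _) intW_greenX intW_greenY addr0.
Qed.

Lemma intWB p q : intW (p - q) = intW p - intW q. Proof. exact: linearB. Qed.
Lemma intWD p q : intW (p + q) = intW p + intW q. Proof. exact: linearD. Qed.
Lemma intWZ k p : intW (k *: p) = k * intW p. Proof. exact: linearZ. Qed.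

End Functional.

(** * Polynomials vanishing on an interval or on the open triangle *)

Section Vanishing.
Local Open Scope classical_set_scope.
Variable R : realType.
Implicit Types (p q : poly2 R) (x y : R).

(** The points [c / (n + 2)] with [n < size P] are distinct roots, more than the degree allows. *)
Lemma poly_itv_eq0 (P : {poly R}) (c : R) : 0 < c ->
  (forall x, 0 < x -> x < c -> P.[x] = 0) -> P = 0.
Proof.
move=> c0 h; pose rs := [seq c / n.+2%:R | n <- iota 0 (size P)].
apply: (@roots_geq_poly_eq0 _ P rs).
- apply/allP => _ /mapP[n _ ->]; apply/eqP; apply: h; first exact: divr_gt0.
  by rewrite ltr_pdivrMr // ltr_pMr // ltr1n.
- rewrite map_inj_uniq ?iota_uniq // => m n /(mulfI (lt0r_neq0 c0)) /invr_inj /eqP.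
  by rewrite eqr_nat => /eqP [].
- by rewrite size_map size_iota.
Qed.

Lemma ev_poly p x : exists P : {poly R}, forall y, P.[y] = ev p x y.
Proof.
exists (\sum_(m <- msupp p) (p@_m * x ^+ m i0) *: 'X^(m i1)) => y.
rewrite [in RHS](mpolyE p) ev_sum horner_sum; apply: eq_bigr => m _.
by rewrite !hornerE evZ ev_mnm mulrA.
Qed.

Lemma mnm2_eq (m m' : 'X_{1.. 2}) : m i0 = m' i0 -> m i1 = m' i1 -> m = m'.
Proof.
move=> e0 e1; apply/mnmP => -[[|[|//]] hi].
  by rewrite (_ : Ordinal hi = i0) //; exact: val_inj.
by rewrite (_ : Ordinal hi = i1) //; exact: val_inj.
Qed.

(** For fixed [y] the polynomial in [x] vanishes on [0 < x < 1 - y]; so each of its coefficients, a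
    polynomial in [y], vanishes on [0 < y < 1]. *)
Lemma ev_triangle_eq0 p :
  (forall x y, 0 < x -> 0 < y -> 0 < 1 - x - y -> ev p x y = 0) -> p = 0.
Proof.
move=> h.
have s (y : R) : 0 < y -> y < 1 ->
   \sum_(m <- msupp p) (p@_m * y ^+ m i1) *: 'X^(m i0) = 0 :> {poly R}.
  move=> y0 y1; apply: (@poly_itv_eq0 _ (1 - y)); first by rewrite subr_gt0.
  move=> x x0 xy; rewrite -(h x y) //; last by lra.
  rewrite [in RHS](mpolyE p) ev_sum horner_sum; apply: eq_bigr => m _.
  by rewrite !hornerE evZ ev_mnm; ring.
have t k : \sum_(m <- msupp p | m i0 == k) p@_m *: 'X^(m i1) = 0 :> {poly R}.
  apply: (@poly_itv_eq0 _ 1) => // y y0 y1.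
  have := congr1 (fun P : {poly R} => P`_k) (s y y0 y1).
  rewrite /= coef0 coef_sum => <-.
  rewrite horner_sum big_mkcond; apply: eq_bigr => m _.
  rewrite coefZ coefXn eq_sym; case: eqP => _; last by rewrite mulr0.
  by rewrite !hornerE ?mulr1 ?expr1n.
apply/mpolyP => m; rewrite mcoeff0; apply/eqP; apply: contraT => hm.
have := congr1 (fun P : {poly R} => P`_(m i1)) (t (m i0)).
rewrite /= coef0 coef_sum -big_filter (bigD1_seq m) /=.
- rewrite big_filter_cond big1 ?addr0.
    by rewrite coefZ coefXn eqxx mulr1 => pm0; rewrite pm0 eqxx in hm.
  move=> m' /andP[/eqP e0 ne]; rewrite coefZ coefXn; case: eqP => [e1|]; last by rewrite mulr0.
  by case/eqP: ne; apply: mnm2_eq.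
- by rewrite mem_filter eqxx mcoeff_msupp.
- exact/filter_uniq/msupp_uniq.
Qed.

End Vanishing.

(** * Positive definiteness of the weighted form *)

Section Positivity.
Local Open Scope classical_set_scope.
Variable R : realType.
Local Notation mu := (@lebesgue_measure R).
Local Notation mu2 := (@lebesgue_measure R \x @lebesgue_measure R)%E.
Implicit Types (p q : poly2 R) (x y : R).

Lemma ev_neq0_near p x0 y0 : ev p x0 y0 != 0 -> 0 < x0 -> 0 < y0 -> 0 < 1 - x0 - y0 ->
  exists2 e : R, 0 < e & forall x y, ball x0 e x -> ball y0 e y ->
     [/\ ev p x y != 0, 0 < x, 0 < y & 0 < 1 - x - y].
Proof.
move=> hp hx hy hxy.
have H0 : \forall z \near (x0, y0), ev p z.1 z.2 != 0.
  exact: (cvgr_neq0 (ev p x0 y0) (@ev_continuous R p (x0, y0)) hp).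
have pos q : 0 < ev q x0 y0 -> \forall z \near (x0, y0), 0 < ev q z.1 z.2.
  exact: (cvgr_gt (ev q x0 y0) (@ev_continuous R q (x0, y0)) 0).
have H1 := pos (pX R); have H2 := pos (pY R); have H3 := pos (onemXY R).
rewrite evX in H1; rewrite evY in H2; rewrite evonemXY in H3.
have hn := filterI H0 (filterI (H1 hx) (filterI (H2 hy) (H3 hxy))).
have /nbhs_ballP[e /= e0 he] := hn (nbhs_filter _) (nbhs_filter _) (nbhs_filter _).
exists e => // x y hx' hy'.
have [|/= h0 [h1 [h2 h3]]] := he (x, y); first by split.
by rewrite evX in h1; rewrite evY in h2; rewrite evonemXY in h3.
Qed.

Variables a b : R.
Hypotheses (ha : -1 < a) (hb : -1 < b).

(** The integrand is nonnegative with integral 0, so it is nonzero only on a null set. A point where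
    [p] does not vanish would put into that set a square of side [2 e], which has positive area. *)
Lemma intW_pos p : intW a b (p * p) = 0 -> p = 0.
Proof.
move=> h; apply: ev_triangle_eq0 => x0 y0 hx hy hxy.
apply/eqP; apply: contraT => hp.
have [e e0 he] := ev_neq0_near hp hx hy hxy.
pose f := polywt a b (p * p * onemXY R).
have fge0 z : @T2 R z -> 0 <= f z.
  move=> [_ [_ hz]]; rewrite /f /polywt !evM evonemXY -expr2.
  by rewrite mulr_ge0 ?wt_ge0 // mulr_ge0 // sqr_ge0.
have fint := polywt_integrable ha hb (p * p * onemXY R).
have fm : measurable_fun (@T2 R) (EFin \o f) by have /integrableP[] := fint.
have I0 : (\int[mu2]_(z in @T2 R) `|(EFin \o f) z| = 0)%E.
  have -> : (\int[mu2]_(z in @T2 R) `|(EFin \o f) z| = \int[mu2]_(z in @T2 R) (f z)%:E)%E.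
    by apply: eq_integral => z; rewrite inE => hz /=; rewrite ger0_norm ?fge0.
  have := integrable_fin_num (@measurable_T2_lebesgue R) fint.
  by move=> /fineK <-; rewrite -[RHS]/(0%:E) -h.
have [N [mN N0 sN]] := (ae_eq_integral_abs mu2 (@measurable_T2_lebesgue R) fm).1 I0.
have sub : ball x0 e `*` ball y0 e `<=` N.
  move=> [x y] /= [bx by_]; apply: sN => /= hf.
  have [h1 h2 h3 h4] := he x y bx by_.
  have : f (x, y) != 0.
    rewrite /f /polywt /wt /= !evM evonemXY !mulf_neq0 //; first exact: lt0r_neq0.
      by rewrite lt0r_neq0 // powR_gt0.
    by rewrite lt0r_neq0 // powR_gt0.
  have /hf /= -[->] : @T2 R (x, y) by rewrite /T2 /= !ltW.
  by rewrite eqxx.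
have mb (c : R) : measurable (ball c e : set (measurableTypeR R)).
  exact: measurable_ball.
have le : (mu2 (ball x0 e `*` ball y0 e) <= mu2 N)%E.
  by apply: le_measure => //; rewrite inE //; exact: measurableX.
have eN : mu2 N = 0%E by exact: N0.
have : (mu2 (ball x0 e `*` ball y0 e) = ((e *+ 2) * (e *+ 2))%:E)%E.
  transitivity (mu (ball x0 e) * mu (ball y0 e))%E; first exact: product_measure1E.
  by rewrite !lebesgue_measure_ball ?ltW // EFinM.
move=> eB; move: le; rewrite eN eB lee_fin leNgt mulr_gt0 //; exact: mulrn_wgt0.
Qed.

End Positivity.

(** * Rodrigues polynomials *)

Section Rodrigues.
Local Open Scope classical_set_scope.
Variable R : realType.
Implicit Types (a b x y t K : R).

(** Pascal's rule, in the shape produced by differentiating one term of the Leibniz sum. *)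
Lemma leibcoefS x y n j : (j <= n)%N ->
  leibcoef x y n.+1 j.+1 = leibcoef x y n j.+1 * (x - (n - j.+1)%:R) - leibcoef x y n j * (y - j%:R).
Proof.
move=> jn; rewrite /leibcoef binS natrD subSS ffrS exprS.
move: jn; rewrite leq_eqVlt => /predU1P[->|jn].
  by rewrite bin_small // subnn; ring.
by rewrite -(subnSK jn) ffrS; ring.
Qed.

Lemma leibcoefS0 x y n : leibcoef x y n.+1 0 = leibcoef x y n 0 * (x - n%:R).
Proof. by rewrite /leibcoef !bin0 !subn0 ffrS; ring. Qed.

Lemma is_derive_powR2 (x y K t : R) : 0 < t -> t < K ->
  is_derive t 1 (fun u : R => u `^ x * (K - u) `^ y)
    (x * (t `^ (x - 1) * (K - t) `^ y) - y * (t `^ x * (K - t) `^ (y - 1))).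
Proof.
move=> t0 tK; have Kt : 0 < K - t by rewrite subr_gt0.
have d1 := @is_derive1_powR R x t t0.
have d2 : is_derive t 1 (fun u : R => (K - u) `^ y) (- (y * (K - t) `^ (y - 1))).
  have h := @is_derive1_powR R y (K - t) Kt.
  have h2 : is_derive t 1 (fun u : R => K - u) (0 - 1) by exact: is_deriveB.
  have := @is_derive1_comp R (fun v => v `^ y) (fun u => K - u) t _ _ h h2.
  by rewrite sub0r mulrN1.
have := is_deriveM d1 d2.
rewrite /GRing.scale /=.
have -> : t `^ x * - (y * (K - t) `^ (y - 1)) + (K - t) `^ y * (x * t `^ (x - 1)) =
  x * (t `^ (x - 1) * (K - t) `^ y) - y * (t `^ x * (K - t) `^ (y - 1)) by ring.
by [].
Qed.

Lemma derive1n_leib x y K n t : 0 < t -> t < K ->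
  derive1n n (fun u : R => u `^ x * (K - u) `^ y) t =
  \sum_(j < n.+1) leibcoef x y n j * (t `^ (x - (n - j)%:R) * (K - t) `^ (y - j%:R)).
Proof.
elim: n t => [|n IH] t t0 tK.
  by rewrite big_ord1 /= /leibcoef bin0 !ffr0 !subr0 expr0 !mul1r.
rewrite derive1nS derive1E.
pose g (j : 'I_n.+1) (u : R) := leibcoef x y n j * (u `^ (x - (n - j)%:R) * (K - u) `^ (y - j%:R)).
(* The induction hypothesis holds on a neighbourhood of [t], so the sum can replace the iterated
   derivative before differentiating. *)
rewrite (@near_eq_derive _ _ _ _ (fun u => \sum_(j < n.+1) g j u)); last first.
  near=> u; apply: IH; near: u; [exact: lt_nbhsr|exact: lt_nbhsl].
have dg (j : 'I_n.+1) : is_derive t 1 (g j) (leibcoef x y n j *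
  ((x - (n - j)%:R) * (t `^ (x - (n - j)%:R - 1) * (K - t) `^ (y - j%:R))
   - (y - j%:R) * (t `^ (x - (n - j)%:R) * (K - t) `^ (y - j%:R - 1)))).
  exact: (is_deriveZ (leibcoef x y n j) (is_derive_powR2 (x - (n - j)%:R) (y - j%:R) t0 tK)).
have -> : (fun u => \sum_(j < n.+1) g j u) = \sum_(j < n.+1) g j.
  by apply/funext => u; rewrite fct_sumE.
have [_ ->] := is_derive_sum dg.
pose A j := t `^ (x - (n.+1 - j)%:R) * (K - t) `^ (y - j%:R).
transitivity (\sum_(j < n.+1) (leibcoef x y n j * (x - (n - j)%:R) * A j
   - leibcoef x y n j * (y - j%:R) * A j.+1)).
  apply: eq_bigr => j _; have jn : (j <= n)%N by rewrite -ltnS.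
  rewrite /A subSS (subSn jn) -!natr1 !opprD !addrA; ring.
rewrite sumrB big_ord_recl [in RHS]big_ord_recl /= leibcoefS0 subn0 -addrA; congr (_ + _).
under [in RHS]eq_bigr => j _.
  rewrite leibcoefS; last by rewrite -ltnS.
  rewrite mulrBl -/(A j.+1). over.
rewrite sumrB; congr (_ - _).
(* The shifted sum on the right has one more term than that on the left; its binomial coefficient is
   0. *)
have l0 : leibcoef x y n n.+1 = 0 by rewrite /leibcoef bin_small // !mul0r.
rewrite [in RHS]big_ord_recr /= l0 !mul0r addr0.
by apply: eq_bigr => j _.
Unshelve. all: by end_near.
Qed.

(** The prefactors of the Rodrigues formula cancel the real exponents in each Leibniz term and leave
    natural powers. The abstract [S], [T] are later two of the three coordinates. *)
Lemma rodr_homjac a b m (s t : R) (S T : poly2 R) x y : 0 < t -> 0 < 1 - s - t ->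
  ev S x y = 1 - s - t -> ev T x y = t ->
  rodr b a m s t = ev (homjac b a m S T) x y.
Proof.
move=> t0 st eS eT; rewrite /rodr derive1n_leib // ?subr_gt0 //; last by lra.
rewrite /homjac ev_sum mulr_sumr; apply: eq_bigr => j _.
have jm : (j <= m)%N by rewrite -ltnS.
rewrite evZ evM !evE eS eT -/(jcoef b a m j).
have e1 : t `^ (- b) * t `^ (b + m%:R - (m - j)%:R) = t ^+ j.
  rewrite -powRD; last by rewrite (lt0r_neq0 t0) implybT.
  by rewrite natrB // -(powR_mulrn _ (ltW t0)); congr (_ `^ _); ring.
have e2 : (1 - s - t) `^ (- a) * (1 - s - t) `^ (a + m%:R - j%:R) = (1 - s - t) ^+ (m - j).
  rewrite -powRD; last by rewrite (lt0r_neq0 st) implybT.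
  by rewrite -(powR_mulrn _ (ltW st)) natrB //; congr (_ `^ _); ring.
by rewrite -e1 -e2; ring.
Qed.

(** Membership prescribes values only on an open region; these contain the open triangle and hence
    determine the polynomial. *)
Lemma H3E a b m P : H3 a b m P <-> exists k, P = k *: homjac b a m (pX R) (pY R).
Proof.
have E x y : 0 < y -> 0 < x -> rodr b a m (1 - x - y) y = ev (homjac b a m (pX R) (pY R)) x y.
  by move=> hy hx; apply: rodr_homjac; rewrite ?evX ?evY //; first lra; ring.
split=> [[k hk]|[k ->]]; exists k; last by move=> x y hx hy; rewrite evZ E.
apply/eqP; rewrite -subr_eq0; apply/eqP; apply: ev_triangle_eq0 => x y hx hy hxy.
by rewrite evB evZ hk // E // subrr.
Qed.

Lemma H2E a b m P : H2 a b m P <-> exists k, P = k *: homjac b a m (onemXY R) (pX R).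
Proof.
have E x y : 0 < x -> 0 < 1 - y - x -> rodr b a m y x = ev (homjac b a m (onemXY R) (pX R)) x y.
  by move=> hy hx; apply: rodr_homjac; rewrite ?evX ?evonemXY //; ring.
split=> [[k hk]|[k ->]]; exists k; last by move=> x y hx hy; rewrite evZ E.
apply/eqP; rewrite -subr_eq0; apply/eqP; apply: ev_triangle_eq0 => x y hx hy hxy.
by rewrite evB evZ hk // ?E // ?subrr //; lra.
Qed.

Lemma H1E a b m P : H1 a b m P <-> exists k, P = k *: homjac b a m (onemXY R) (pY R).
Proof.
have E x y : 0 < y -> 0 < 1 - x - y -> rodr b a m x y = ev (homjac b a m (onemXY R) (pY R)) x y.
  by move=> hy hx; apply: rodr_homjac; rewrite ?evY ?evonemXY //; ring.
split=> [[k hk]|[k ->]]; exists k; last by move=> x y hx hy; rewrite evZ E.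
apply/eqP; rewrite -subr_eq0; apply/eqP; apply: ev_triangle_eq0 => x y hx hy hxy.
by rewrite evB evZ hk // ?E // ?subrr //; lra.
Qed.

Lemma homjac_eigXY a b m : Lop a b (-1) (homjac b a m (pX R) (pY R)) =
  eigval a b (-1) m *: homjac b a m (pX R) (pY R).
Proof.
rewrite (@homjac_eig _ b a m _ _ (Lop a b (-1))); last first.
  move=> i j; have := Lop_bary a b (-1) i j 0.
  rewrite /bary !expr0 !mulr1 mul0r scale0r addr0 addn0 /= => ->.
  by congr (_ - _ *: _); ring.
by congr (_ *: _); rewrite /eigval; ring.
Qed.

(** In [homjac b a m S T] the exponent [a] goes with [S] and [b] with [T]. Here [z] has exponent
    [a], [x] has [b], and the absent [y] has [-1]. *)
Lemma homjac_eigZX a b m : Lop b (-1) a (homjac b a m (onemXY R) (pX R)) =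
  eigval b (-1) a m *: homjac b a m (onemXY R) (pX R).
Proof.
rewrite (@homjac_eig _ b a m _ _ (Lop b (-1) a)); last first.
  move=> i j; have := Lop_bary b (-1) a j 0 i.
  rewrite /bary !expr0 !mulr1 mul0r scale0r addr0 addn0.
  rewrite ![pX R ^+ _ * _]mulrC /= => ->.
  by rewrite [X in X - _]addrC; congr (_ - _ *: _); ring.
by congr (_ *: _); rewrite /eigval; ring.
Qed.

Lemma homjac_eigZY a b m : Lop (-1) b a (homjac b a m (onemXY R) (pY R)) =
  eigval (-1) b a m *: homjac b a m (onemXY R) (pY R).
Proof.
rewrite (@homjac_eig _ b a m _ _ (Lop (-1) b a)); last first.
  move=> i j; have := Lop_bary (-1) b a 0 j i.
  rewrite /bary !expr0 !mul1r mul0r scale0r add0r add0n.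
  rewrite ![pY R ^+ _ * _]mulrC /= => ->.
  by rewrite [X in X - _]addrC; congr (_ - _ *: _); ring.
by congr (_ *: _); rewrite /eigval; ring.
Qed.

(** Only the term [j = 0] survives, with coefficient [(b + 1) ... (b + m)], which is positive. *)
Lemma ev_homjac1 a b m (S T : poly2 R) x y : ev S x y = 1 -> ev T x y = 0 -> -1 < b ->
  ev (homjac b a m S T) x y != 0.
Proof.
move=> eS eT hb; rewrite /homjac ev_sum big_ord_recl big1 => [|j _].
  rewrite addr0 evZ evM !evE eS eT expr0 expr1n !mulr1 /jcoef /leibcoef bin0 subn0 expr0 ffr0.
  by rewrite !(mul1r, mulr1) lt0r_neq0 //; apply: ffr_gt0; lra.
by rewrite evZ evM !evE eT /bump /= exprS mul0r !mulr0.
Qed.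

End Rodrigues.

(** * Orthogonal polynomials for [W a b 1] *)

Section OrthogonalSpace.
Local Open Scope classical_set_scope.
Variable R : realType.
Variables a b : R.
Hypotheses (ha : -1 < a) (hb : -1 < b).
Implicit Types (p q u : poly2 R).
Local Notation intW := (intW a b).
Local Notation L := (Lop a b 1).
Local Notation lam := (eigval a b 1).

Lemma eigval_sub_neq0 m d : (d < m)%N -> lam m - lam d != 0.
Proof.
move=> dm; rewrite subr_eq0 eq_sym; apply: eigval_inj; rewrite ?(ltW ha) ?(ltW hb) //.
by right; move: ha hb; lra.
Qed.

Lemma intW0 : intW 0 = 0.
Proof. by have := intWZ ha hb 0 0; rewrite scaler0 mul0r. Qed.

(** Induction on the degree [d] of the test polynomial: modulo lower degree [L] multiplies it by
    [lam d], so symmetry gives [lam m * I = lam d * I] for the integral [I] of the product. *)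
Lemma eigen_orthogonal m u q :
  L u = lam m *: u -> (msize q <= m)%N -> intW (u * q) = 0.
Proof.
move=> hu; suff h d p : (d <= m)%N -> (msize p <= d)%N -> intW (u * p) = 0 by exact: h.
elim: d p => [|d IH] p dm hp.
  by move: hp; rewrite leqn0 mmeasure_poly_eq0 => /eqP ->; rewrite mulr0 intW0.
have := Lop_selfadjoint ha hb u p; rewrite hu -scalerAr intWZ // mulrC [p * u]mulrC.
have hr := IH _ (ltnW dm) (Lop_size a b 1 hp).
rewrite -[L p](subrK (lam d *: p)) mulrDr intWD // hr add0r -scalerAr intWZ // => e.
apply: (mulfI (eigval_sub_neq0 dm)); rewrite mulr0 mulrBl.
by rewrite -e mulrC subrr.
Qed.

Definition eigscale m : R := \prod_(i < m) (lam m - lam i).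

Lemma eigscale_neq0 m : eigscale m != 0.
Proof. by apply/prodf_neq0 => i _; exact: eigval_sub_neq0. Qed.

(** For the direct implication, the rescaled [eigcomp] of [p] is an eigenpolynomial [e] with the
    leading part of [p]. Then [e - p] has degree below [m], so it is orthogonal to [e] and to [p],
    hence to itself. *)
Lemma Vsp_eigen (m : nat) p :
  Vsp a b 1 m%:Z p <-> (msize p <= m.+1)%N /\ L p = lam m *: p.
Proof.
rewrite /Vsp /=; split=> [[hs ho]|[hs he]]; split=> //; last first.
  by move=> q hq; rewrite inner_lf // (eigen_orthogonal he hq).
have ho' q : (msize q <= m)%N -> intW (p * q) = 0.
  by move=> /ho; rewrite inner_lf // => -[].
pose e := (eigscale m)^-1 *: eigcomp a b 1 m p.
have eE : L e = lam m *: e.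
  by rewrite linearZ /= eigcomp_eig // !scalerA mulrC.
have re : (msize (e - p) <= m)%N.
  have := eigcomp_lead a b 1 m hs; rewrite -/(eigscale m) => h.
  have -> : e - p = (eigscale m)^-1 *: (eigcomp a b 1 m p - eigscale m *: p).
    by rewrite scalerBr scalerA mulVf ?eigscale_neq0 // scale1r.
  exact: msize_le_Z.
have : e - p = 0.
  apply: (intW_pos ha hb); rewrite mulrBl intWB //.
  by rewrite (eigen_orthogonal eE re) ho' // subrr.
by move/eqP; rewrite subr_eq0 => /eqP <-.
Qed.

Definition mon2 (i j : nat) : 'X_{1.. 2} := (U_(i0) *+ i + U_(i1) *+ j)%MM.

Lemma mon2_0 i j : mon2 i j i0 = i.
Proof. by rewrite mnmDE !mulmnE !mnm1E /= ?(muln1, mul1n, muln0, mul0n, addn0). Qed.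
Lemma mon2_1 i j : mon2 i j i1 = j.
Proof. by rewrite mnmDE !mulmnE !mnm1E /= ?(muln1, mul1n, muln0, mul0n, add0n). Qed.

Lemma msize_lead_eq0 m p : (msize p <= m.+1)%N ->
  (forall i : 'I_m.+1, p@_(mon2 (m - i) i) = 0) -> (msize p <= m)%N.
Proof.
move=> hs h0; rewrite msizeE; apply/bigmax_leqP_seq => m' hm' _.
have : (mdeg m' < m.+1)%N by exact: leq_trans (msize_mdeg_lt hm') hs.
rewrite ltnS leq_eqVlt => /predU1P[e|//].
have hi : (m' i1 < m.+1)%N by rewrite ltnS -e mdeg2 leq_addl.
move: hm'; rewrite mcoeff_msupp => /negP[]; rewrite -(h0 (Ordinal hi)); apply/eqP.
by congr mcoeff; apply: mnm2_eq; rewrite ?mon2_0 ?mon2_1 //= -e mdeg2 addnK.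
Qed.

Definition topform m (c : 'I_m.+1 -> R) : poly2 R :=
  \sum_(i < m.+1) c i *: 'X_[mon2 (m - i) i].

Lemma mdeg_mon2 i j : mdeg (mon2 i j) = (i + j)%N.
Proof. by rewrite mdeg2 mon2_0 mon2_1. Qed.

Lemma msize_topform m c : (msize (@topform m c) <= m.+1)%N.
Proof.
apply: (big_ind (fun q : poly2 R => msize q <= m.+1)%N); first by rewrite mmeasure0.
  by move=> *; exact: msize_le_D.
move=> i _; apply: msize_le_Z; rewrite msizeX mdeg_mon2 subnK // -ltnS.
exact: ltn_ord.
Qed.

Lemma coef_topform m c (i : 'I_m.+1) : (@topform m c)@_(mon2 (m - i) i) = c i.
Proof.
rewrite /topform raddf_sum /= (bigD1 i) //= big1 ?addr0.
  by rewrite mcoeffZ mcoeffX eqxx mulr1.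
move=> j ji; rewrite mcoeffZ mcoeffX; case: eqP => [e|]; last by rewrite mulr0.
by case/eqP: ji; apply: val_inj; rewrite /= -(mon2_1 (m - j) j) e mon2_1.
Qed.

(** Indexing by [k = m + 1] includes the zero space of degree [-1]. The polynomials [eigcomp] of the
    monomials of degree [m] have independent leading parts; they span because an eigenpolynomial of
    degree [m] without leading part is 0. *)
Lemma Vsp_dim k : has_dim (Vsp a b 1 (k%:Z - 1)) k.
Proof.
case: k => [|m].
  exists (fun=> 0); split; first by move=> c _ [].
  apply/predeqP => p; split; first by move=> ->; exists (fun=> 0); rewrite big_ord0.
  by move=> [c ->]; rewrite big_ord0.
have -> : m.+1%:Z - 1 = m%:Z by rewrite -addn1 PoszD addrK.
pose f (i : 'I_m.+1) : poly2 R := eigcomp a b 1 m 'X_[mon2 (m - i) i].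
have fE c : \sum_(i < m.+1) c i *: f i = eigcomp a b 1 m (topform c).
  by rewrite /topform linear_sum; apply: eq_bigr => i _; rewrite linearZ.
have lead c := eigcomp_lead a b 1 m (msize_topform c).
have lead0 c (i : 'I_m.+1) : (eigcomp a b 1 m (topform c))@_(mon2 (m - i) i) = eigscale m * c i.
  have : (mon2 (m - i) i) \notin msupp (eigcomp a b 1 m (topform c) - eigscale m *: topform c).
    apply: msize_mdeg_ge; rewrite mdeg_mon2 subnK; first exact: lead.
    by rewrite -ltnS.
  by move/memN_msupp_eq0/eqP; rewrite mcoeffB mcoeffZ coef_topform subr_eq0 => /eqP.
exists f; split.
  move=> c; rewrite fE => h i; have := lead0 c i.
  by rewrite h mcoeff0 => /esym/eqP; rewrite mulf_eq0 (negbTE (eigscale_neq0 m)) => /eqP.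
apply/predeqP => p; rewrite Vsp_eigen; split; last first.
  move=> [c ->]; rewrite fE; split; last by apply: eigcomp_eig; exact: msize_topform.
  rewrite -[eigcomp _ _ _ _ _](subrK (eigscale m *: topform c)).
  apply: msize_le_D; first exact/leqW/lead.
  exact/msize_le_Z/msize_topform.
move=> [hs he]; pose c (i : 'I_m.+1) := (eigscale m)^-1 * p@_(mon2 (m - i) i).
exists c; rewrite fE; apply/eqP; rewrite -subr_eq0; apply: contraT => h.
have hsz : (msize (p - eigcomp a b 1 m (topform c)) <= m)%N.
  apply: msize_lead_eq0.
    apply: msize_le_B => //.
    rewrite -[eigcomp _ _ _ _ _](subrK (eigscale m *: topform c)).
    apply: msize_le_D; first exact/leqW/lead.
    exact/msize_le_Z/msize_topform.
  by move=> i; rewrite mcoeffB lead0 /c mulVKf ?eigscale_neq0 // subrr.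
have e : msize (p - eigcomp a b 1 m (topform c)) = m.+1.
  apply: (@eigen_msize R a b 1 m); rewrite ?(ltW ha) ?(ltW hb) //.
  - by right; move: ha hb; lra.
  - by rewrite linearB /= he (eigcomp_eig _ _ _ (msize_topform c)) scalerBr.
  - exact: leqW.
by move: hsz; rewrite e ltnn.
Qed.

End OrthogonalSpace.

(** * Direct sums and dimensions *)

Section Dimension.
Local Open Scope classical_set_scope.
Variable R : realType.
Implicit Types (p q u v : poly2 R) (A U : set (poly2 R)) (Ss : seq (set (poly2 R))).

Lemma sumL_nil u : sumL [::] u <-> u = 0.
Proof.
split=> [[f [_ ->]]|->]; first by rewrite big_ord0.
by exists (fun=> 0); split; [case | rewrite big_ord0].
Qed.

(** Replaces indexed families by a recursion on the list, so that later arguments split off one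
    summand at a time. *)
Lemma sumL_cons A Ss u :
  sumL (A :: Ss) u <-> exists v w, [/\ A v, sumL Ss w & u = v + w].
Proof.
split=> [[f [fA ->]]|[v [w [Av [g [gS ->]] ->]]]].
  exists (f ord0), (\sum_(i < size Ss) f (lift ord0 i)); split.
  - exact: (fA ord0).
  - by exists (fun i => f (lift ord0 i)); split=> // i; exact: (fA (lift ord0 i)).
  - by rewrite big_ord_recl.
exists (fun i : 'I_(size Ss).+1 => if unlift ord0 i is Some j then g j else v); split.
  by move=> i; case: unliftP => [j ->|->] //=; exact: gS.
rewrite [RHS]big_ord_recl unlift_none; congr (_ + _).
by apply: eq_bigr => i _; rewrite liftK.
Qed.

Lemma directL_nil : directL ([::] : seq (set (poly2 R))).
Proof. by move=> f _ _ []. Qed.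

(** Directness reduces to independence of each summand from the sum of those after it;
    [has_dim_cons] takes the same hypothesis. *)
Lemma directL_cons A Ss :
  (forall v w, A v -> sumL Ss w -> v + w = 0 -> v = 0) ->
  directL Ss -> directL (A :: Ss).
Proof.
move=> indep dS f fA; rewrite /= big_ord_recl => f0.
have fS (i : 'I_(size Ss)) : nth set0 Ss i (f (lift ord0 i)) by exact: (fA (lift ord0 i)).
have v0 : f ord0 = 0.
  by apply: (indep _ _ (fA ord0) _ f0); exists (fun i => f (lift ord0 i)).
move=> i; case: (unliftP ord0 i) => [j ->|-> //].
by move: f0; rewrite v0 add0r => f0; apply: (dS (fun i => f (lift ord0 i)) fS f0 j).
Qed.

Lemma has_dim_nil : has_dim (sumL ([::] : seq (set (poly2 R)))) 0.
Proof.
exists (fun=> 0); split=> [c _ [//]|].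
apply/predeqP => u; rewrite sumL_nil; split=> [->|[c ->]]; last by rewrite big_ord0.
by exists (fun=> 0); rewrite big_ord0.
Qed.

Lemma has_dim_cons A Ss k l :
  (forall v w, A v -> sumL Ss w -> v + w = 0 -> v = 0) ->
  has_dim A k -> has_dim (sumL Ss) l -> has_dim (sumL (A :: Ss)) (k + l).
Proof.
move=> indep [f [f_free fA]] [g [g_free gS]].
pose h (i : 'I_(k + l)) := match fintype.split i with inl j => f j | inr j => g j end.
have hE c : \sum_(i < k + l) c i *: h i =
    \sum_(i < k) c (lshift l i) *: f i + \sum_(i < l) c (rshift k i) *: g i.
  rewrite big_split_ord; congr (_ + _); apply: eq_bigr => i _; rewrite /h.
    by rewrite (unsplitK (inl i)).
  by rewrite (unsplitK (inr i)).
exists h; split.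
  move=> c; rewrite hE => c0.
  have f0 : \sum_(i < k) c (lshift l i) *: f i = 0.
    apply: (indep _ _ _ _ c0); first by rewrite fA; exists (fun i => c (lshift l i)).
    by rewrite gS; exists (fun i => c (rshift k i)).
  move: c0; rewrite f0 add0r => g0 i; rewrite -[i]splitK.
  by case: (fintype.split i) => j; [exact: (f_free _ f0) | exact: (g_free _ g0)].
apply/predeqP => u; rewrite sumL_cons fA gS; split.
  move=> [_ [_ [[c ->] [d ->] ->]]].
  exists (fun i => match fintype.split i with inl j => c j | inr j => d j end).
  rewrite hE; congr (_ + _); apply: eq_bigr => i _.
    by rewrite (unsplitK (inl i)).
  by rewrite (unsplitK (inr i)).
move=> [c ->]; rewrite hE; eexists; eexists; split; last reflexivity.
  by exists (fun i => c (lshift l i)).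
by exists (fun i => c (rshift k i)).
Qed.

Lemma has_dim_line U q : q != 0 -> (forall p, U p <-> exists k, p = k *: q) -> has_dim U 1.
Proof.
move=> q0 hU; exists (fun=> q); split.
  move=> c /eqP; rewrite big_ord1 scaler_eq0 (negbTE q0) orbF => /eqP c0 i.
  by rewrite ord1.
apply/predeqP => p; rewrite hU; split=> [[k ->]|[c ->]].
  by exists (fun=> k); rewrite big_ord1.
by exists (c ord0); rewrite big_ord1.
Qed.

Lemma has_dim_mulS U q d : q != 0 -> has_dim U d -> has_dim (mulS q U) d.
Proof.
move=> q0 [f [f_free fU]]; exists (fun i => q * f i).
have E c : \sum_(i < d) c i *: (q * f i) = q * \sum_(i < d) c i *: f i.
  by rewrite mulr_sumr; apply: eq_bigr => i _; rewrite scalerAr.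
split=> [c|].
  by rewrite E => /eqP; rewrite mulf_eq0 (negbTE q0) => /eqP /f_free.
apply/predeqP => p; rewrite /mulS fU; split=> [[_ [c ->] ->]|[c ->]].
  by exists c; rewrite E.
by exists (\sum_(i < d) c i *: f i); [exists c | rewrite E].
Qed.

End Dimension.

(** * Eigenfunctions among the summands, and restriction to edges and vertices *)

Section EigenElements.
Local Open Scope classical_set_scope.
Variable R : realType.
Implicit Types (a b c : R) (p q u v : poly2 R).

(** The degree is only bounded, so that the predicate contains 0 and is stable under sums;
    [eigen_msize] recovers the exact degree. *)
Definition eigen a b c n u := Lop a b c u = eigval a b c n *: u /\ (msize u <= n.+1)%N.

Lemma eigen0 a b c n : eigen a b c n 0.
Proof. by split; rewrite ?linear0 ?scaler0 // mmeasure0. Qed.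

Lemma eigenD a b c n u v : eigen a b c n u -> eigen a b c n v -> eigen a b c n (u + v).
Proof.
by move=> [eu su] [ev sv]; split; [rewrite linearD /= eu ev scalerDr | exact: msize_le_D].
Qed.

Lemma eigenZ a b c n k u : eigen a b c n u -> eigen a b c n (k *: u).
Proof.
move=> [eu su]; split; last exact: msize_le_Z.
by rewrite linearZ /= eu !scalerA mulrC.
Qed.

Lemma eigen_mulX b c n u : eigen 1 b c n u -> eigen (-1) b c n.+1 (pX R * u).
Proof.
move=> [eu su]; split; last by apply: (@msize_le_M _ 1); first exact: msize_X.
rewrite Lop_X eu -scalerBl -scalerAr; congr (_ *: _).
by rewrite /eigval -natr1; ring.
Qed.

Lemma eigen_mulY a c n u : eigen a 1 c n u -> eigen a (-1) c n.+1 (pY R * u).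
Proof.
move=> [eu su]; split; last by apply: (@msize_le_M _ 1); first exact: msize_Y.
rewrite Lop_Y eu -scalerBl -scalerAr; congr (_ *: _).
by rewrite /eigval -natr1; ring.
Qed.

Lemma eigen_mulZ a b n u : eigen a b 1 n u -> eigen a b (-1) n.+1 (onemXY R * u).
Proof.
move=> [eu su]; split; last by apply: (@msize_le_M _ 1); first exact: msize_Z.
rewrite Lop_Z eu -scalerBl -scalerAr; congr (_ *: _).
by rewrite /eigval -natr1; ring.
Qed.

Lemma Vsp_eigen_pred a b k p : -1 < a -> -1 < b -> Vsp a b 1 (k%:Z - 1) p ->
  p = 0 \/ exists2 m, k = m.+1 & eigen a b 1 m p.
Proof.
move=> ha hb; case: k => [|m]; first by left.
have -> : m.+1%:Z - 1 = m%:Z by rewrite -addn1 PoszD addrK.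
by move=> /(Vsp_eigen ha hb)[hs he]; right; exists m.
Qed.

Lemma eigen_space_of a b c n (U : set (poly2 R)) : -1 <= a -> -1 <= b -> -1 <= c ->
  (1 < n)%N \/ -3 < a + b + c ->
  (forall u, U u -> eigen a b c n u) -> has_dim U n.+1 -> eigen_space a b c n U.
Proof.
move=> ha hb hc hn hU hd; split; last split=> //.
  by move=> u /hU[].
by move=> u /hU[eu su] u0; apply: eigen_msize ha hb hc hn eu su u0.
Qed.

Lemma ev_neq0 p x y : ev p x y != 0 -> p != 0.
Proof. by apply: contraNneq => ->; rewrite ev0. Qed.

Lemma pX_neq0 : pX R != 0.
Proof. by apply: (@ev_neq0 _ 1 0); rewrite evX oner_neq0. Qed.
Lemma pY_neq0 : pY R != 0.
Proof. by apply: (@ev_neq0 _ 0 1); rewrite evY oner_neq0. Qed.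
Lemma onemXY_neq0 : onemXY R != 0.
Proof. by apply: (@ev_neq0 _ 0 0); rewrite evonemXY !subr0 oner_neq0. Qed.

Lemma H3_eigen a b m p : H3 a b m p -> eigen a b (-1) m p.
Proof.
move=> /H3E[k ->]; apply: eigenZ; split; first exact: homjac_eigXY.
by apply: homjac_msize; [exact: msize_X | exact: msize_Y].
Qed.

Lemma H2_eigen a b m p : H2 a b m p -> eigen b (-1) a m p.
Proof.
move=> /H2E[k ->]; apply: eigenZ; split; first exact: homjac_eigZX.
by apply: homjac_msize; [exact: msize_Z | exact: msize_X].
Qed.

Lemma H1_eigen a b m p : H1 a b m p -> eigen (-1) b a m p.
Proof.
move=> /H1E[k ->]; apply: eigenZ; split; first exact: homjac_eigZY.
by apply: homjac_msize; [exact: msize_Z | exact: msize_Y].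
Qed.

(** A generator that is nonzero at some point gives both the dimension and the injectivity of
    evaluation there. *)
Lemma line_spec (U : set (poly2 R)) q x y : ev q x y != 0 ->
  (forall p, U p <-> exists k, p = k *: q) ->
  has_dim U 1 /\ (forall p, U p -> ev p x y = 0 -> p = 0).
Proof.
move=> hq hU; split; first exact: has_dim_line (ev_neq0 hq) hU.
move=> p /hU[k ->] /eqP; rewrite evZ mulf_eq0 (negbTE hq) orbF => /eqP ->.
by rewrite scale0r.
Qed.

(** The vertex [(1, 0)] is where [S = x] is 1 and [T = y] is 0. For the other two families, with
    [S = z], it is the origin. *)
Lemma H3_line a b m : -1 < b ->
  has_dim (H3 a b m) 1 /\ (forall p, H3 a b m p -> ev p 1 0 = 0 -> p = 0).
Proof.
move=> hb; apply: line_spec (@H3E R a b m).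
by rewrite ev_homjac1 ?evX ?evY.
Qed.

Lemma H2_line a b m : -1 < b ->
  has_dim (H2 a b m) 1 /\ (forall p, H2 a b m p -> ev p 0 0 = 0 -> p = 0).
Proof.
move=> hb; apply: line_spec (@H2E R a b m).
by rewrite ev_homjac1 ?evX ?evonemXY ?subr0.
Qed.

Lemma H1_line a b m : -1 < b ->
  has_dim (H1 a b m) 1 /\ (forall p, H1 a b m p -> ev p 0 0 = 0 -> p = 0).
Proof.
move=> hb; apply: line_spec (@H1E R a b m).
by rewrite ev_homjac1 ?evY ?evonemXY ?subr0.
Qed.

(** Restriction to a point where the common factor of the other summands vanishes isolates [B]. *)
Lemma restrict_Z A B : onemXY R * A + B = 0 -> ev B 1 0 = 0.
Proof.
move=> /(congr1 (fun p => ev p 1 0)).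
by rewrite evD evM evonemXY ev0 subrr subr0 mul0r add0r.
Qed.

Lemma restrict_Y A B : pY R * A + onemXY R * B = 0 -> ev B 0 0 = 0.
Proof.
move=> /(congr1 (fun p => ev p 0 0)).
by rewrite evD !evM evonemXY evY ev0 !subr0 mul0r mul1r add0r.
Qed.

(* The factor [y (1 - x - y)] vanishes at the origin, but [B] restricted to the
   edge [x = 0] is a polynomial vanishing on [0 < y < 1]. *)
Lemma restrict_X A B : pX R * A + pY R * onemXY R * B = 0 -> ev B 0 0 = 0.
Proof.
move=> h; have [P hP] := ev_poly B 0.
rewrite -hP (@poly_itv_eq0 _ P 1) ?horner0 // => y y0 y1.
have := congr1 (fun p => ev p 0 y) h.
rewrite evD !evM evX evY evonemXY ev0 mul0r add0r subr0 hP => /eqP.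
rewrite !mulf_eq0 (gt_eqF y0) subr_eq0 (gt_eqF y1) => /eqP //.
Qed.

End EigenElements.

(** * The three families of spaces *)

Section Cases.
Local Open Scope classical_set_scope.
Variable R : realType.
Implicit Types (p u v w : poly2 R).
Local Notation X := (pX R).
Local Notation Y := (pY R).
Local Notation Z := (onemXY R).

Lemma Ua_eigen_space (al be : R) n : -1 < al -> -1 < be ->
  eigen_space al be (-1) n (Ua al be n) /\ directL (summands_a al be n).
Proof.
move=> ha hb; rewrite /Ua /summands_a.
have [dim3 eq3] := H3_line al n hb.
have ind1 v w : mulS Z (Vsp al be 1 (n%:Z - 1)) v -> sumL [:: H3 al be n] w ->
    v + w = 0 -> v = 0.
  move=> [p _ ->] /sumL_cons[p3 [z [h3 /sumL_nil -> ->]]]; rewrite addr0 => h.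
  by move: (h); rewrite (eq3 _ h3 (restrict_Z h)) addr0.
have ind2 v w : H3 al be n v -> sumL [::] w -> v + w = 0 -> v = 0.
  by move=> _ /sumL_nil ->; rewrite addr0.
split; last exact: directL_cons ind1 (directL_cons ind2 (@directL_nil R)).
apply: eigen_space_of; rewrite ?(ltW ha) ?(ltW hb) //; first by right; lra.
  move=> u /sumL_cons[_ [_ [[p hp ->] /sumL_cons[p3 [_ [h3 /sumL_nil -> ->]]] ->]]].
  rewrite addr0; apply: eigenD; last exact: H3_eigen.
  have [->|[m -> hm]] := Vsp_eigen_pred ha hb hp; first by rewrite mulr0; exact: eigen0.
  exact: eigen_mulZ.
have -> : n.+1 = (n + 1)%N by rewrite addn1.
apply: has_dim_cons ind1 _ _.
  exact: has_dim_mulS (onemXY_neq0 R) (Vsp_dim ha hb n).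
exact: has_dim_cons ind2 dim3 (has_dim_nil R).
Qed.

Lemma has_dim_span1 : has_dim (spanL [:: 1 : poly2 R]) 1.
Proof.
apply: (@has_dim_line _ _ 1); first exact: oner_neq0.
move=> p; split=> [[c ->]|[k ->]].
  by exists (c ord0); rewrite big_ord1.
by exists (fun=> k); rewrite big_ord1.
Qed.

Lemma span1_eigen (a b c : R) u : spanL [:: 1] u -> eigen a b c 0 u.
Proof.
move=> [k ->]; rewrite big_ord1; apply: eigenZ; split; last by rewrite mmeasure1.
by rewrite /= /Lop !deriv2E /eigval mul0r oppr0 scale0r; ring.
Qed.

Lemma Ub_eigen_space (al : R) n : -1 < al ->
  eigen_space al (-1) (-1) n (Ub al n) /\ ((0 < n)%N -> directL (summands_b al n)).
Proof.
move=> ha; have h1 : -1 < 1 :> R by lra.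
case: n => [|m].
  split=> //; apply: eigen_space_of; rewrite ?(ltW ha) //; first by right; lra.
    exact: span1_eigen.
  exact: has_dim_span1.
rewrite /Ub /summands_b /=.
(* Now [Vsp_dim] and [Vsp_eigen_pred] apply, including at [m = 0], where the space is zero. *)
have -> : m.+1%:Z - 2 = m%:Z - 1 by rewrite -addn1 PoszD; ring.
have [dim3 eq3] := H3_line al m h1; have [dim2 eq2] := H2_line 1 m ha.
have ind1 v w : mulS (Y * Z) (Vsp al 1 1 (m%:Z - 1)) v ->
    sumL [:: mulS Y (H3 al 1 m); mulS Z (H2 1 al m)] w -> v + w = 0 -> v = 0.
  move=> [p _ ->] /sumL_cons[_ [_ [[p3 h3 ->]
    /sumL_cons[_ [_ [[p2 h2 ->] /sumL_nil -> ->]]] ->]]].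
  have -> : Y * Z * p + (Y * p3 + (Z * p2 + 0)) = Y * (Z * p + p3) + Z * p2 by ring.
  (* The value at the origin forces [p2 = 0]; after division by [Y], the value at [(1, 0)] forces
     [p3 = 0]. *)
  move=> h; move: (h); rewrite (eq2 _ h2 (restrict_Y h)) mulr0 addr0 => /eqP.
  rewrite mulf_eq0 (negbTE (pY_neq0 R)) => /eqP h'.
  by move: (h'); rewrite (eq3 _ h3 (restrict_Z h')) addr0 -mulrA => ->; rewrite mulr0.
have ind2 v w : mulS Y (H3 al 1 m) v -> sumL [:: mulS Z (H2 1 al m)] w ->
    v + w = 0 -> v = 0.
  move=> [p _ ->] /sumL_cons[_ [_ [[p2 h2 ->] /sumL_nil -> ->]]].
  by rewrite addr0 => h; move: (h); rewrite (eq2 _ h2 (restrict_Y h)) mulr0 addr0.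
have ind3 v w : mulS Z (H2 1 al m) v -> sumL [::] w -> v + w = 0 -> v = 0.
  by move=> _ /sumL_nil ->; rewrite addr0.
split; last first.
  by move=> _; exact: directL_cons ind1 (directL_cons ind2 (directL_cons ind3 (@directL_nil R))).
apply: eigen_space_of; rewrite ?(ltW ha) //; first by right; lra.
  move=> u /sumL_cons[_ [_ [[p hp ->] /sumL_cons[_ [_ [[p3 h3 ->]
    /sumL_cons[_ [_ [[p2 h2 ->] /sumL_nil -> ->]]] ->]]] ->]]].
  rewrite addr0; apply: eigenD; last apply: eigenD.
  - have [->|[j -> hj]] := Vsp_eigen_pred ha h1 hp; first by rewrite mulr0; exact: eigen0.
    by rewrite -mulrA; exact/eigen_mulY/eigen_mulZ.
  - exact/eigen_mulY/H3_eigen.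
  - exact/eigen_mulZ/H2_eigen.
(* The orthogonal space contributes [m] dimensions and each Rodrigues line one. *)
have dm : m.+2 = (m + 2)%N by rewrite addn2.
rewrite [X in has_dim _ X]dm; apply: has_dim_cons ind1 _ _.
  apply: has_dim_mulS; last exact: Vsp_dim.
  by rewrite mulf_neq0 ?pY_neq0 ?onemXY_neq0.
apply: (@has_dim_cons _ _ _ 1 1) ind2 (has_dim_mulS (pY_neq0 R) dim3) _.
exact: has_dim_cons ind3 (has_dim_mulS (onemXY_neq0 R) dim2) (has_dim_nil R).
Qed.

(** With all exponents [-1] the first-order coefficients of the operator vanish, so it kills every
    polynomial of degree at most 1, and the eigenvalue of degree 1 is indeed 0. *)
Lemma span_linear_eigen (c1 c2 : R) u :
  spanL [:: X + pC c1; Y + pC c2] u -> eigen (-1) (-1) (-1) 1 u.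
Proof.
move=> [k ->]; rewrite big_ord_recl big_ord1 /=.
have lam0 : eigval (-1) (-1) (-1) 1 = 0 :> R by rewrite /eigval; ring.
have pCD x y : pC (x + y) = pC x + pC y :> poly2 R by exact: mpolyCD.
have szC c : (msize (pC c) <= 2)%N by rewrite msizeC; case: (c != 0).
apply: eigenD; apply: eigenZ; split.
- by rewrite lam0 scale0r /Lop !deriv2E /pC; ring.
- by apply: msize_le_D => //; exact: msize_X.
- by rewrite lam0 scale0r /Lop !deriv2E /pC; ring.
- by apply: msize_le_D => //; exact: msize_Y.
Qed.

(** Stated through derivatives, this gives both linear independence and the fact that no nonzero
    combination is constant. *)
Lemma span_linear_free (c1 c2 k l : R) :
  dX (k *: (X + pC c1) + l *: (Y + pC c2)) = 0 ->
  dY (k *: (X + pC c1) + l *: (Y + pC c2)) = 0 -> k = 0 /\ l = 0.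
Proof.
rewrite -!mul_mpolyC -!/(pC _) !deriv2E !mul0r !add0r !addr0 !mulr0 !mulr1 ?addr0 ?add0r.
by move=> /eqP + /eqP; rewrite !mpolyC_eq0 => /eqP -> /eqP ->.
Qed.

Lemma span_linear_dim (c1 c2 : R) : has_dim (spanL [:: X + pC c1; Y + pC c2]) 2.
Proof.
exists (fun i => [:: X + pC c1; Y + pC c2]`_i); split=> // c.
rewrite big_ord_recl big_ord1 /= => h i.
have [|| e0 e1] := @span_linear_free c1 c2 (c ord0) (c (lift ord0 ord0)).
- by rewrite h dX0.
- by rewrite h dY0.
by case: (unliftP ord0 i) => [j ->|-> //]; rewrite (ord1 j).
Qed.

Lemma Uc_eigen_space (c1 c2 : R) n :
  eigen_space (-1) (-1) (-1) n (Uc c1 c2 n) /\ ((1 < n)%N -> directL (summands_c R n)).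
Proof.
have h1 : -1 < 1 :> R by lra.
case: n => [|[|m]].
- split=> //; split; last split; last exact: has_dim_span1.
    by move=> u /(@span1_eigen (-1) (-1) (-1))[].
  move=> u [k ->]; rewrite big_ord1 /= => /eqP ku.
  rewrite msizeZ ?mmeasure1 //; apply/eqP => k0; apply: ku.
  by rewrite k0 scale0r.
- split=> //; split; last split; last exact: span_linear_dim.
    by move=> u /span_linear_eigen[].
  move=> u hu u0; have [_ hs] := span_linear_eigen hu.
  (* An element of smaller size is constant; its derivatives vanish, and with them both
     coefficients. *)
  apply/eqP; rewrite eqn_leq hs ltnNge; apply/negP => /msize1_polyC hc.
  move: hu u0 => [k]; rewrite big_ord_recl big_ord1 /= => hk /eqP[].
  have [|| e0 e1] := @span_linear_free c1 c2 (k ord0) (k (lift ord0 ord0)).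
  - by rewrite -hk hc; exact: dXC.
  - by rewrite -hk hc; exact: dYC.
  by rewrite hk e0 e1 !scale0r addr0.
rewrite /Uc /summands_c.
have -> : m.+2%:Z - 3 = m%:Z - 1 by rewrite -addn2 PoszD; ring.
have -> : (m.+2 - 2)%N = m by rewrite subn2.
have [dim3 eq3] := H3_line 1 m h1.
have [dim2 eq2] := H2_line 1 m h1.
have [dim1 eq1] := H1_line 1 m h1.
have ind1 v w : mulS (X * Y * Z) (Vsp 1 1 1 (m%:Z - 1)) v ->
    sumL [:: mulS (X * Y) (H3 1 1 m); mulS (X * Z) (H2 1 1 m); mulS (Y * Z) (H1 1 1 m)] w ->
    v + w = 0 -> v = 0.
  move=> [p _ ->] /sumL_cons[_ [_ [[p3 h3 ->] /sumL_cons[_ [_ [[p2 h2 ->]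
    /sumL_cons[_ [_ [[p1 hp1 ->] /sumL_nil -> ->]]] ->]]] ->]]].
  have -> : X * Y * Z * p + (X * Y * p3 + (X * Z * p2 + (Y * Z * p1 + 0))) =
    X * (Y * (Z * p + p3) + Z * p2) + Y * Z * p1 by ring.
  (* The edge [x = 0] removes [p1]; after division by [X] the origin removes [p2]; after division by
     [Y] the vertex [(1, 0)] removes [p3]. *)
  move=> h; move: (h); rewrite (eq1 _ hp1 (restrict_X h)) mulr0 addr0 => /eqP.
  rewrite mulf_eq0 (negbTE (pX_neq0 R)) => /eqP h'.
  move: (h'); rewrite (eq2 _ h2 (restrict_Y h')) mulr0 addr0 => /eqP.
  rewrite mulf_eq0 (negbTE (pY_neq0 R)) => /eqP h''.
  by move: (h''); rewrite (eq3 _ h3 (restrict_Z h'')) addr0 -!mulrA => ->; rewrite !mulr0.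
have ind2 v w : mulS (X * Y) (H3 1 1 m) v ->
    sumL [:: mulS (X * Z) (H2 1 1 m); mulS (Y * Z) (H1 1 1 m)] w -> v + w = 0 -> v = 0.
  move=> [p _ ->] /sumL_cons[_ [_ [[p2 h2 ->]
    /sumL_cons[_ [_ [[p1 hp1 ->] /sumL_nil -> ->]]] ->]]].
  have -> : X * Y * p + (X * Z * p2 + (Y * Z * p1 + 0)) =
    X * (Y * p + Z * p2) + Y * Z * p1 by ring.
  move=> h; move: (h); rewrite (eq1 _ hp1 (restrict_X h)) mulr0 addr0 => /eqP.
  rewrite mulf_eq0 (negbTE (pX_neq0 R)) => /eqP h'.
  by move: (h'); rewrite (eq2 _ h2 (restrict_Y h')) mulr0 addr0 -mulrA => ->; rewrite mulr0.
have ind3 v w : mulS (X * Z) (H2 1 1 m) v -> sumL [:: mulS (Y * Z) (H1 1 1 m)] w ->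
    v + w = 0 -> v = 0.
  move=> [p _ ->] /sumL_cons[_ [_ [[p1 hp1 ->] /sumL_nil -> ->]]].
  have -> : X * Z * p + (Y * Z * p1 + 0) = X * (Z * p) + Y * Z * p1 by ring.
  by move=> h; move: (h); rewrite (eq1 _ hp1 (restrict_X h)) mulr0 addr0 mulrA.
have ind4 v w : mulS (Y * Z) (H1 1 1 m) v -> sumL [::] w -> v + w = 0 -> v = 0.
  by move=> _ /sumL_nil ->; rewrite addr0.
split; last first.
  move=> _; apply: directL_cons ind1 (directL_cons ind2 _).
  exact: directL_cons ind3 (directL_cons ind4 (@directL_nil R)).
apply: eigen_space_of => //; first by left.
  move=> u /sumL_cons[_ [_ [[p hp ->] /sumL_cons[_ [_ [[p3 h3 ->]
    /sumL_cons[_ [_ [[p2 h2 ->] /sumL_cons[_ [_ [[p1 hp1 ->]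
    /sumL_nil -> ->]]] ->]]] ->]]] ->]]].
  rewrite addr0; apply: eigenD; last (apply: eigenD; last apply: eigenD).
  - have [->|[j -> hj]] := Vsp_eigen_pred h1 h1 hp.
      by rewrite mulr0; exact: eigen0.
    rewrite -(mulrA (X * Y) Z p) -(mulrA X Y (Z * p)).
    exact/eigen_mulX/eigen_mulY/eigen_mulZ.
  - by rewrite -(mulrA X Y p3); exact/eigen_mulX/eigen_mulY/H3_eigen.
  - by rewrite -(mulrA X Z p2); exact/eigen_mulX/eigen_mulZ/H2_eigen.
  - by rewrite -(mulrA Y Z p1); exact/eigen_mulY/eigen_mulZ/H1_eigen.
have dm : m.+3 = (m + 3)%N by rewrite addn3.
rewrite [X in has_dim _ X]dm; apply: has_dim_cons ind1 _ _.
  apply: has_dim_mulS; last exact: Vsp_dim.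
  by rewrite !mulf_neq0 ?pX_neq0 ?pY_neq0 ?onemXY_neq0.
apply: (@has_dim_cons _ _ _ 1 2) ind2 (has_dim_mulS _ dim3) _.
  by rewrite mulf_neq0 ?pX_neq0 ?pY_neq0.
apply: (@has_dim_cons _ _ _ 1 1) ind3 (has_dim_mulS _ dim2) _.
  by rewrite mulf_neq0 ?pX_neq0 ?onemXY_neq0.
apply: has_dim_cons ind4 (has_dim_mulS _ dim1) (has_dim_nil R).
by rewrite mulf_neq0 ?pY_neq0 ?onemXY_neq0.
Qed.

End Cases.

Theorem theorem3p1 (R : realType) (al be : R) (n : nat) :
  -1 < al -> -1 < be ->
  (eigen_space al be (-1) n (Ua al be n) /\ directL (summands_a al be n)) /\
  (eigen_space al (-1) (-1) n (Ub al n) /\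
     ((0 < n)%N -> directL (summands_b al n))) /\
  (forall c1 c2 : R,
     eigen_space (-1) (-1) (-1) n (Uc c1 c2 n) /\
     ((1 < n)%N -> directL (summands_c R n))).
Proof.
move=> hal hbe; split; first exact: Ua_eigen_space.
split; first exact: Ub_eigen_space.
by move=> c1 c2; exact: Uc_eigen_space.
Qed.
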